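(* Let $(M,\tau,\ell,\mathfrak m)$ be a forward metric measure spacetime, $E\subset M$ a Borel set, and $\boldsymbol\pi$ an initial test plan which stays initially in $E$. Let $p^{-1}+q^{-1}=1$ with $0\ne q<1$. Let $f:M\to\bar{\mathbb R}$ be a causal function and assume that (i) if $p<0$, then $|\mathrm df|^p\in L^1(E,\mathfrak m|_E)$; (ii) if $q<0$, then $\liminf_{t\downarrow0}\frac1{tq}\iint_0^t|\dot\gamma_r|^q\,\mathrm dr\,\mathrm d\boldsymbol\pi(\gamma)>-\infty$. Then $$\liminf_{t\downarrow0}\int\frac{f(\gamma_t)-f(\gamma_0)}t\,\mathrm d\boldsymbol\pi(\gamma)\ \ge\ \frac1p\int|\mathrm df|^p(\gamma_0)\,\mathrm d\boldsymbol\pi(\gamma)+\liminf_{t\downarrow0}\frac1{tq}\iint_0^t|\dot\gamma_r|^q\,\mathrm dr\,\mathrm d\boldsymbol\pi(\gamma).$$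
   Context: Conventions in $\bar{\mathbb R}=[-\infty,+\infty]$: $+\infty-(+\infty)=+\infty$, $-\infty-(-\infty)=+\infty$, $\pm\infty+z=\pm\infty$ for every $z\in\bar{\mathbb R}$, $0\cdot(\pm\infty)=0$. For $0\ne r<1$ and $z\in[0,\infty]$, $z^r$ has the limiting values: if $r<0$ then $0^r=+\infty$ and $(+\infty)^r=0$; if $r>0$ then $0^r=0$ and $(+\infty)^r=+\infty$. Spacetimes. A time separation on a set $M$ is a map $\ell:M\times M\to\{-\infty\}\cup[0,+\infty]$ with $\ell(x,x)=0$ and $\min\{\ell(x,y)+\ell(y,z),\ell(y,z)+\ell(x,y)\}\le\ell(x,z)$; write $x\le y$ if $\ell(x,y)\ge0$. A forward metric measure spacetime $(M,\tau,\ell,\mathfrak m)$: $\tau$ is a Polish topology, $\ell$ a time separation with $\le$ a partial order and $\{\ell\ge0\}$ closed in $M^2$, every sequence with $x_n\le x_{n+1}\le\bar x$ for all $n$ and some $\bar x$ converges, and $\mathfrak m$ is a non-zero non-negative Radon measure. Curves. $\gamma:[0,1]\to M$ is causal if $s\le t$ implies $\gamma_s\le\gamma_t$. Its causal speed $|\dot\gamma_t|\in[0,+\infty]$ is the density of the absolutely continuous part (w.r.t. Lebesgue measure) of the largest Borel measure $\nu$ on $[0,1]$ with $\nu((a,b))\le\ell(\gamma_a,\gamma_b)$ for all $0\le a<b\le1$; for a.e. $t$ it equals $\lim_{h\downarrow0}\ell(\gamma_t,\gamma_{t+h})/h$. $\mathrm{LCC}([0,1];M)$ is the set of left-continuous causal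 curves with the topology of the distance $\mathsf D(\gamma,\eta)=\mathsf d(\gamma_0,\eta_0)+\int_0^1\mathsf d(\gamma_t,\eta_t)\,\mathrm dt$, $\mathsf d$ a bounded distance inducing $\tau$. $\mathsf e_t(\gamma):=\gamma_t$. Subslopes. A causal function is an $\mathfrak m$-measurable $f:M\to\bar{\mathbb R}$ such that $x\le y$ implies $f(x)\le f(y)$. A test plan is a Borel probability measure $\boldsymbol\pi$ on $\mathrm{LCC}([0,1];M)$ such that for some $C>0$, $(\mathsf e_t)_*\boldsymbol\pi\le C\mathfrak m$ for all $t\in[0,1]$. A Borel $G:M\to[0,+\infty]$ is a weak subslope of $f$ if $\int[f(\gamma_1)-f(\gamma_0)]\,\mathrm d\boldsymbol\pi\ge\iint_0^1G(\gamma_t)|\dot\gamma_t|\,\mathrm dt\,\mathrm d\boldsymbol\pi$ for every test plan $\boldsymbol\pi$; $|\mathrm df|$ denotes the $\mathfrak m$-a.e. largest weak subslope (it exists and is $\mathfrak m$-a.e. unique). Initial test plans. A Borel probability measure $\boldsymbol\pi$ on $\mathrm{LCC}([0,1];M)$ is an initial test plan if for some $T\in(0,1)$, $C>0$ we have $(\mathsf e_t)_*\boldsymbol\pi\le C\mathfrak m$ for all $t\in[0,T]$, and $(\mathsf e_t)_*\boldsymbol\pi\to(\mathsf e_0)_*\boldsymbol\pi$ narrowly as $t\downarrow0$. It stays initially in $E$ if for some $T\in(0,1]$ the measure $(\mathsf e_t)_*\boldsymbol\pi$ is concentrated on $E$ for all $t\in[0,T]$. *)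

(* Defs.v *)
From HB Require Import structures.
From mathcomp Require Import all_boot all_order all_algebra.
From mathcomp Require Import all_classical all_reals all_analysis.
From mathcomp Require Import measurable_realfun.

Set Implicit Arguments.
Unset Strict Implicit.
Unset Printing Implicit Defensive.

Import Order.TTheory GRing.Theory Num.Theory.
Import numFieldNormedType.Exports.

Local Open Scope classical_set_scope.
Local Open Scope ring_scope.
Local Open Scope ereal_scope.

Section extended_reals.
Context {R : realType}.
Implicit Types x y z : \bar R.

(* Sum with the convention [±oo + z = ±oo] for every [z]: an infinite left
   operand wins. *)
Definition eadd x y : \bar R := if x is r%:E then r%:E + y else x.

(* Difference with the convention [+oo - (+oo) = -oo - (-oo) = +oo]; in
   [dual_adde], unlike in [adde], [+oo] absorbs [-oo]. *)
Definition ediff x y : \bar R := dual_adde x (- y).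

(* Powers of [z] in [0, +oo]. The library's [poweR] and [powR] do not have the
   limiting values at [0] and [+oo] when [r < 0]. The value at [-oo] is junk. *)
Definition epow z (r : R) : \bar R :=
  match z with
  | s%:E => if (r < 0)%R && (s == 0%R) then +oo else (s `^ r)%:E
  | +oo => if (r < 0)%R then 0 else +oo
  | -oo => 0
  end.

End extended_reals.

Section metrizability.
Context {R : realType} {M : topologicalType}.
Implicit Type d : M -> M -> R.

Definition is_distance d : Prop :=
  [/\ forall x y, d x y = 0%R <-> x = y,
      forall x y, d x y = d y x
    & forall x y z, (d x z <= d x y + d y z)%R].

Definition induces_topology d : Prop :=
  forall (x : M) (U : set M),
    nbhs x U <-> exists2 e : R, (0 < e)%R & [set y | (d x y < e)%R] `<=` U.

Definition complete_distance d : Prop :=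
  forall u : nat -> M,
    (forall e : R, (0 < e)%R -> exists N : nat, forall i j : nat,
      (N <= i)%N -> (N <= j)%N -> (d (u i) (u j) < e)%R) ->
    exists x : M, u @ \oo --> x.

Definition bounded_distance d : Prop :=
  exists K : R, forall x y, (d x y <= K)%R.

End metrizability.

Definition polish (R : realType) (M : topologicalType) : Prop :=
  (exists2 D : set M, countable D & dense D) /\
  exists d : M -> M -> R,
    [/\ is_distance d, induces_topology d & complete_distance d].

Notation borel M := (g_sigma_algebraType (@open M)).

Definition radon (R : realType) (M : ptopologicalType)
    (m : {measure set (borel M) -> \bar R}) : Prop :=
  (forall x : M, exists U : set M, [/\ open U, U x & m U < +oo]) /\
  (forall A : set (borel M), measurable A ->
    m A = ereal_sup [set m K | K in [set K : set M | compact K /\ K `<=` A]]).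

Definition time_separation (R : realType) (M : Type) (ell : M -> M -> \bar R)
    : Prop :=
  [/\ forall x y, ell x y = -oo \/ 0 <= ell x y,
      forall x, ell x x = 0
    & forall x y z, mine (eadd (ell x y) (ell y z)) (eadd (ell y z) (ell x y))
                    <= ell x z].

(* The reference measure is nonzero, so the carrier is nonempty and asking for
   it to be pointed is no restriction. *)
Record fmm_spacetime (R : realType) := FmmSpacetime {
  carrier :> ptopologicalType ;
  ell : carrier -> carrier -> \bar R ;
  refm : {measure set (borel carrier) -> \bar R} ;
  carrier_polish : polish R carrier ;
  ell_time_separation : time_separation ell ;
  ell_order :
    [/\ forall x, 0 <= ell x x,
        forall x y, 0 <= ell x y -> 0 <= ell y x -> x = y
      & forall x y z, 0 <= ell x y -> 0 <= ell y z -> 0 <= ell x z] ;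
  ell_closed : closed [set xy : carrier * carrier | 0 <= ell xy.1 xy.2] ;
  forward_complete : forall (u : nat -> carrier) (b : carrier),
    (forall n, 0 <= ell (u n) (u n.+1) /\ 0 <= ell (u n.+1) b) ->
    exists x : carrier, u @ \oo --> x ;
  refm_radon : radon refm ;
  refm_neq0 : refm setT != 0 }.
Arguments ell {R} _ _ _.
Arguments refm {R} _.

Section curves.
Context {R : realType} (X : fmm_spacetime R).

Definition causal_le (x y : X) : Prop := 0 <= ell X x y.

(* A left-continuous causal curve [0,1] -> X is represented by its extension
   to the real line that is constant on ]-oo, 0] and on [1, +oo[; each curve
   thus has exactly one representative. *)
Definition is_lcc (g : R -> X) : Prop :=
  [/\ forall s t : R, (0 <= s)%R -> (s <= t)%R -> (t <= 1)%R ->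
        causal_le (g s) (g t),
      forall t : R, (0 < t)%R -> (t <= 1)%R -> g s @[s --> t^'-] --> g t,
      forall t : R, (t <= 0)%R -> g t = g 0%R
    & forall t : R, (1 <= t)%R -> g t = g 1%R].

Record LCC := MkLCC { lcc_fun :> R -> X ; lcc_funP : is_lcc lcc_fun }.

Lemma is_lcc_cst (x : X) : is_lcc (fun=> x).
Proof.
by split=> // *; [rewrite /causal_le; case: (ell_order X)|exact: cvg_cst].
Qed.

HB.instance Definition _ := gen_eqMixin LCC.
HB.instance Definition _ := gen_choiceMixin LCC.
HB.instance Definition _ := isPointed.Build LCC (MkLCC (is_lcc_cst point)).

Definition ev (t : R) (g : LCC) : borel X := g t.

Definition lcc_dist (d : X -> X -> R) (g h : LCC) : \bar R :=
  (d (g 0%R) (h 0%R))%:E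
  + \int[lebesgue_measure]_(t in `[0%R, 1%R]%classic) (d (g t) (h t))%:E.

Definition lcc_open (d : X -> X -> R) : set (set LCC) :=
  [set U | forall g, U g ->
    exists2 e : R, (0 < e)%R & forall h, lcc_dist d g h < e%:E -> U h].

(* A Borel measure on [0,1] is encoded as a Borel measure on the line that
   does not charge the complement of [0,1]. *)
Definition admissible (g : LCC)
    (nu : {measure set R -> \bar R}) : Prop :=
  nu (~` `[0%R, 1%R]%classic) = 0 /\
  forall a b : R, (0 <= a)%R -> (a < b)%R -> (b <= 1)%R ->
    nu `]a, b[%classic <= ell X (g a) (g b).

Definition largest_admissible (g : LCC)
    (nu : {measure set R -> \bar R}) : Prop :=
  admissible g nu /\
  forall nu' : {measure set R -> \bar R},
    admissible g nu' -> forall A, measurable A -> nu' A <= nu A.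

(* The absolutely continuous part, as the largest absolutely continuous measure
   below [nu]. It is the absolutely continuous term of the Lebesgue
   decomposition of [nu] whenever there is one. The decomposition may fail to
   exist: the largest admissible [nu] has infinite mass at the endpoints, and
   also at every inner point if [ell] is [+oo] along the curve; in the latter
   case the largest absolutely continuous minorant has density [+oo]. *)
Definition ac_part (nu al : {measure set R -> \bar R})
    : Prop :=
  let below_ac (be : {measure set R -> \bar R}) :=
    be `<< (lebesgue_measure : set R -> \bar R) /\
    forall A, measurable A -> be A <= nu A in
  below_ac al /\
  forall be : {measure set R -> \bar R},
    below_ac be -> forall A, measurable A -> be A <= al A.

(* [v] is a version of the causal speed [t |-> |g'_t|] on [0,1]; it is
   determined up to Lebesgue-null sets. *)
Definition is_causal_speed (g : LCC) (v : R -> \bar R) : Prop :=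
  [/\ measurable_fun (`[0%R, 1%R]%classic : set R) v,
      forall t : R, (0 <= t)%R -> (t <= 1)%R -> 0 <= v t
    & exists nu al : {measure set R -> \bar R},
        [/\ largest_admissible g nu, ac_part nu al
          & forall A : set R,
              measurable A -> A `<=` `[0%R, 1%R]%classic ->
              al A = \int[lebesgue_measure]_(t in A) v t]].

End curves.

Notation lcc_borel d := (g_sigma_algebraType (lcc_open d)).

(* The integral of a nonnegative function whenever the latter is measurable,
   also with respect to the completion of [mu]. *)
Definition upper_integral (d : measure_display) (T : measurableType d)
    (R : realType) (mu : set T -> \bar R) (F : T -> \bar R) : \bar R :=
  ereal_inf [set \int[mu]_x h x | h in
    [set h : T -> \bar R | measurable_fun setT h /\ forall x, F x <= h x]].

Section subslopes.
Context {R : realType} (X : fmm_spacetime R).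

(* Measurability of [f] is with respect to the [refm X]-completion of the
   Borel sigma-algebra. *)
Definition causal_function (f : X -> \bar R) : Prop :=
  (forall Y : set (\bar R), measurable Y ->
    completed_algebra_gen (refm X) (f @^-1` Y)) /\
  (forall x y : X, causal_le x y -> f x <= f y).

Variables (d : X -> X -> R) (speed : LCC X -> R -> \bar R).

Definition bounded_compression (pi : probability (lcc_borel d) R) (t C : R)
    : Prop :=
  forall A : set (borel X), measurable A ->
    pushforward pi (@ev R X t) A <= C%:E * refm X A.

Definition test_plan (pi : probability (lcc_borel d) R) : Prop :=
  exists2 C : R, (0 < C)%R &
    forall t : R, (0 <= t)%R -> (t <= 1)%R -> bounded_compression pi t C.

(* Since [ell] is not assumed to be Borel, measurability in [g] of the inner
   integral is not guaranteed; the outer integral is therefore an upper one,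
   which is the ordinary integral whenever that makes sense. *)
Definition weak_subslope (f G : X -> \bar R) : Prop :=
  [/\ measurable_fun setT (G : borel X -> \bar R),
      forall x, 0 <= G x
    & forall pi : probability (lcc_borel d) R, test_plan pi ->
        upper_integral pi (fun g : LCC X =>
          \int[lebesgue_measure]_(t in `[0%R, 1%R]%classic) (G (g t) * speed g t))
        <= \int[pi]_g ediff (f ((g : LCC X) 1%R)) (f ((g : LCC X) 0%R))].

(* [G] is a representative of [|df|]. *)
Definition maximal_weak_subslope (f G : X -> \bar R) : Prop :=
  weak_subslope f G /\
  forall G', weak_subslope f G' ->
    {ae refm X, forall x : borel X, G' x <= G x}.

Definition initial_test_plan (pi : probability (lcc_borel d) R) : Prop :=
  (exists T C : R, [/\ (0 < T)%R, (T < 1)%R, (0 < C)%R &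
    forall t : R, (0 <= t)%R -> (t <= T)%R -> bounded_compression pi t C]) /\
  (forall phi : X -> R, continuous phi ->
    (exists K : R, forall x, (`|phi x| <= K)%R) ->
    (\int[pushforward pi (@ev R X t)]_x (phi x)%:E) @[t --> (0%R : R)^'+]
      --> \int[pushforward pi (@ev R X 0%R)]_x (phi x)%:E).

Definition stays_initially_in (pi : probability (lcc_borel d) R)
    (E : set (borel X)) : Prop :=
  exists T : R, [/\ (0 < T)%R, (T <= 1)%R &
    forall t : R, (0 <= t)%R -> (t <= T)%R ->
      pushforward pi (@ev R X t) (~` E) = 0].

(* [(t q)^-1 * \iint_0^t |g'_r|^q dr dpi(g)] *)
Definition mean_speed_power (pi : probability (lcc_borel d) R) (q t : R)
    : \bar R :=
  ((t * q)^-1)%:E *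
  \int[pi]_g \int[lebesgue_measure]_(r in `[0%R, t]%classic) epow (speed g r) q.

End subslopes.

(* Main.v *)
Require Import Defs.
From HB Require Import structures.
From mathcomp Require Import all_boot all_order all_algebra.
From mathcomp Require Import all_classical all_reals all_analysis.
From mathcomp Require Import measurable_realfun.
From mathcomp Require Import ring lra.
Set Implicit Arguments.
Unset Strict Implicit.
Unset Printing Implicit Defensive.
Import Order.TTheory GRing.Theory Num.Theory.
Import numFieldNormedType.Exports.
Local Open Scope classical_set_scope.
Local Open Scope ring_scope.
Local Open Scope ereal_scope.
Import HBNNSimple.

(* Restricting curves to [0, t] and reparametrizing on [0, 1] turns an initial
   test plan into a test plan, whose speed dominates t |g'_(t s)|. The weak
   subslope inequality then bounds the difference quotient from below by
   (1/t) \iint_0^t |df|(g_r) |g'_r| dr dpi, and the reverse Young inequality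
   a b >= a^p / p + b^q / q splits this into a subslope and a speed term.
   In the subslope term, the bound (e_r)_* pi <= C m upgrades the narrow
   convergence (e_r)_* pi -> (e_0)_* pi to convergence on every Borel set, by
   approximating Borel sets with compact and open sets in m-measure. Hence
   r |-> \int G d(e_r)_* pi is lower semicontinuous at 0 for every Borel G >= 0,
   and upper semicontinuous if moreover G is m-integrable on E.
   Neither f (g_t) - f (g_0) nor \int_0^t |g'_r|^q dr need be measurable in g, so
   integrals are handled as suprema over simple functions from below;
   of the two terms of Young's inequality the subslope one is measurable, which is
   what makes lower and upper integrals add up. *)

(** * Lower and upper integrals *)

Definition image_measure {d d'} {T : measurableType d} {T' : measurableType d'}
    {R : realFieldType} (mu : {measure set T -> \bar R}) {phi : T -> T'}
    (mphi : measurable_fun setT phi) : {measure set T' -> \bar R}.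
Proof. refine (pushforward mu phi : {measure set T' -> \bar R}). exact: mphi. Defined.

Section lower_integral.
Context d (T : measurableType d) (R : realType).
(** The integral of a nonnegative function is a supremum over the simple functions below it, so it
    is monotone for arbitrary functions; for nonmeasurable ones it is the lower integral. *)
Lemma le_lower_integral (mu : {measure set T -> \bar R}) (D : set T)
    (f g : T -> \bar R) :
  (forall x, D x -> 0 <= f x) -> (forall x, D x -> f x <= g x) ->
  \int[mu]_(x in D) f x <= \int[mu]_(x in D) g x.
Proof.
move=> f0 fg.
have g0 x : D x -> 0 <= g x by move=> Dx; exact: le_trans (f0 _ Dx) (fg _ Dx).
rewrite !ge0_integralE//; apply: ge_ereal_sup => _ [h /= hf <-].
apply: ereal_sup_ubound; exists h => // x.
by apply: le_trans (hf x) _; apply: lee_restrict.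
Qed.

Lemma lower_integralZl (mu : {measure set T -> \bar R}) (k : R)
    (f : T -> \bar R) :
  (0 < k)%R -> (forall x, 0 <= f x) ->
  \int[mu]_x (k%:E * f x) = k%:E * \int[mu]_x f x.
Proof.
(* Scaling simple functions gives one inequality; the other is the same one for [k^-1] and [k f]. *)
have half (c : R) (g : T -> \bar R) : (0 < c)%R -> (forall x, 0 <= g x) ->
    c%:E * \int[mu]_x g x <= \int[mu]_x (c%:E * g x).
  move=> c0 g0; rewrite muleC -lee_pdivlMr//.
  rewrite ge0_integralTE//; apply: ge_ereal_sup => _ [h /= hg <-].
  rewrite lee_pdivlMr// muleC -sintegralrM.
  rewrite ge0_integralTE; last by move=> x; rewrite mule_ge0// lee_fin ltW.
  apply: ereal_sup_ubound; exists (scale_nnsfun h (ltW c0)) => // x /=.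
  by rewrite EFinM lee_pmul2l// lte_fin.
move=> k0 f0; apply/eqP; rewrite eq_le half// andbT.
have kf0 x : 0 <= k%:E * f x by rewrite mule_ge0// lee_fin ltW.
have k'0 : (0 < k^-1)%R by rewrite invr_gt0.
have := half _ _ k'0 kf0.
under [X in _ <= X -> _]eq_integral do
  rewrite muleA -EFinM mulVf ?gt_eqF// mul1e.
by rewrite muleC lee_pdivrMr// muleC.
Qed.

End lower_integral.

(** Simple functions below [f] pull back to simple functions below [f \o phi]. The converse can
    fail, since a simple function below [f \o phi] need not factor through [phi]. *)
Lemma lower_integral_pushforward d d' (T : measurableType d)
    (T' : measurableType d') (R : realType) (mu : {measure set T -> \bar R})
    (phi : {mfun T >-> T'}) (f : T' -> \bar R) :
  (forall x, 0 <= f x) ->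
  \int[pushforward mu phi]_x f x <= \int[mu]_x f (phi x).
Proof.
move=> f0; rewrite [X in X <= _]ge0_integralTE//; apply: ge_ereal_sup => _ [h /= hf <-].
rewrite -integralT_nnsfun ge0_integral_pushforward//=; last 2 first.
- exact/measurable_EFinP.
- by move=> y _; rewrite lee_fin.
by apply: le_lower_integral => x _ /=; rewrite ?lee_fin.
Qed.

Section upper_integral.
Context d d' (T : measurableType d) (T' : measurableType d') (R : realType).

Lemma upper_integral_pushforward (mu : {measure set T -> \bar R})
    (phi : {mfun T >-> T'}) (F : T -> \bar R) (G : T' -> \bar R) :
  (forall x, 0 <= G x) -> (forall x, F x <= G (phi x)) ->
  upper_integral mu F <= upper_integral (pushforward mu phi) G.
Proof.
move=> G0 FG; apply: le_ereal_inf_tmp => _ [h [mh Gh] <-].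
rewrite ge0_integral_pushforward//=; last first.
  by move=> y _; exact: le_trans (Gh y).
apply: ereal_inf_lbound; exists (h \o phi) => //; split.
  exact: measurableT_comp.
by move=> x; exact: le_trans (FG x) (Gh _).
Qed.

End upper_integral.

Section upper_lower.
Context d (T : measurableType d) (R : realType) (mu : {measure set T -> \bar R}).
Implicit Types (F A B : T -> \bar R).

(** Passing to the infimum over measurable majorants [h] means moving a finite [c] across the
    inequality, hence the separate case [c = +oo]. *)
Let le_upper_integralD F (S c : \bar R) : (forall x, 0 <= F x) -> 0 <= c ->
  (forall h, measurable_fun setT h -> (forall x, F x <= h x) ->
    S <= \int[mu]_x h x + c) ->
  S <= upper_integral mu F + c.
Proof.
move=> F0 c0 Sh.
have u0 : 0 <= upper_integral mu F.
  apply: le_ereal_inf_tmp => _ [h [mh Fh] <-]; apply: integral_ge0 => x _.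
  exact: le_trans (F0 x) (Fh x).
have [->|cfin] := eqVneq c +oo.
  by rewrite addey ?leey// gt_eqF// (lt_le_trans _ u0).
have {}cfin : c \is a fin_num by rewrite ge0_fin_numE// lt_neqAle cfin leey.
rewrite -leeBlDr//; apply: le_ereal_inf_tmp => _ [h [mh Fh] <-].
by rewrite leeBlDr//; exact: Sh.
Qed.

(** A measurable majorant [h] of [F] gives [B <= h + A], and the integral of this sum of measurable
    functions splits. *)
Lemma lower_integral_le_upperD F A B :
  (forall x, 0 <= F x) -> (forall x, 0 <= A x) -> (forall x, 0 <= B x) ->
  measurable_fun setT A -> (forall x, B x <= F x + A x) ->
  \int[mu]_x B x <= upper_integral mu F + \int[mu]_x A x.
Proof.
move=> F0 A0 B0 mA BFA; apply: le_upper_integralD => //; first exact: integral_ge0.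
move=> h mh Fh; have h0 x : 0 <= h x by exact: le_trans (F0 x) (Fh x).
rewrite -ge0_integralD//; apply: le_lower_integral => // x _.
by apply: le_trans (BFA x) _; rewrite leeD2r.
Qed.

(** Here the measurable function stands on the left. For a measurable majorant [h] of [F], the
    positive part [w] of [A - h] is measurable, lies below [B], and satisfies [A <= h + w]. *)
Lemma integral_le_upper_lowerD F A B :
  (forall x, 0 <= F x) -> (forall x, 0 <= A x) -> (forall x, 0 <= B x) ->
  measurable_fun setT A -> (forall x, A x <= F x + B x) ->
  \int[mu]_x A x <= upper_integral mu F + \int[mu]_x B x.
Proof.
move=> F0 A0 B0 mA AFB; apply: le_upper_integralD => //; first exact: integral_ge0.
move=> h mh Fh; have h0 x : 0 <= h x by exact: le_trans (F0 x) (Fh x).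
pose w x := maxe (A x - h x) 0.
have w0 x : 0 <= w x by rewrite le_max lexx orbT.
have mw : measurable_fun setT w.
  by apply: measurable_maxe => //; exact: emeasurable_funB.
apply: (@le_trans _ _ (\int[mu]_x (h x + w x))).
  apply: le_lower_integral => // x _.
  have [->|hfin] := eqVneq (h x) +oo.
    by rewrite addye ?leey// gt_eqF// (lt_le_trans _ (w0 x))// ltNy0.
  have {}hfin : h x \is a fin_num by rewrite ge0_fin_numE// lt_neqAle hfin leey.
  by rewrite addeC -leeBlDr// /w le_max lexx.
rewrite ge0_integralD//; apply: leeD2l; apply: le_lower_integral => // x _.
rewrite /w ge_max B0 andbT.
(* In [adde], [-oo] absorbs [+oo], so [A x - h x] is [-oo] here even if [A x] is [+oo]. *)
have [->|hfin] := eqVneq (h x) +oo; first by rewrite addeNy leNye.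
have {}hfin : h x \is a fin_num by rewrite ge0_fin_numE// lt_neqAle hfin leey.
rewrite leeBlDr// addeC; apply: le_trans (AFB x) _.
by rewrite leeD2r.
Qed.

End upper_lower.

(** * Calculus on the real line *)

(** A point [t] of [A] lies in some [I q]: choose a rational [q < t] with [[q, t]] inside [A]. Each
    [I q] is an interval, so [A] is a countable union of intervals. *)
Lemma left_open_measurable (R : realType) (A : set R) :
  (forall t, A t -> exists2 e : R, (0 < e)%R &
    forall s, (t - e < s)%R -> (s <= t)%R -> A s) ->
  measurable A.
Proof.
move=> lA.
pose I (q : rat) : set R :=
  [set t | (ratr q <= t)%R /\ forall s, (ratr q <= s)%R -> (s <= t)%R -> A s].
suff -> : A = \bigcup_q I q.
  apply: bigcupT_measurable_rat => q; apply: is_interval_measurable.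
  move=> x y [qx _] [_ yA] z /andP[xz zy]; split; first exact: le_trans qx xz.
  by move=> s qs sz; apply: yA => //; exact: le_trans sz zy.
apply/seteqP; split=> [t At|t [q _ [qt]]]; last exact.
have [e e0 eA] := lA _ At.
have te : (t - e < t)%R by rewrite ltrBlDr ltrDl.
have [q] := rat_in_itvoo te; rewrite in_itv/= => /andP[q1 q2].
exists q => //; split; first exact: ltW.
by move=> s qs st; apply: eA => //; exact: lt_le_trans q1 qs.
Qed.

Section scaling.
Context (R : realType) (t : R).
Hypothesis t0 : (0 < t)%R.
Local Notation leb := (@lebesgue_measure R).

Let scale (x : measurableTypeR R) : measurableTypeR R := (t * x)%R.

Let measurable_scale : measurable_fun setT scale.
Proof.
have : measurable_fun setT (fun x : R => (t * x)%R) by exact: measurable_funM.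
exact.
Qed.

Let scaled : {measure set (measurableTypeR R) -> \bar R} :=
  mscale (NngNum (ltW t0)) (image_measure leb measurable_scale).

Lemma lebesgue_measure_scale (A : set R) : measurable A ->
  leb A = t%:E * leb [set x | A (t * x)%R].
Proof.
move=> mA.
rewrite -[RHS]/(scaled A); apply: lebesgue_measure_unique => // X /ocitvP[->|].
  by rewrite !measure0.
move=> [[a b] /= ab ->]; rewrite /scaled/= /mscale/= /pushforward.
rewrite (_ : scale @^-1` _ = `](a / t)%R, (b / t)%R]%classic); last first.
  apply/seteqP; split=> x /=; rewrite !in_itv/=;
    by rewrite ltr_pdivrMr// ler_pdivlMr// (mulrC x).
rewrite !lebesgue_measure_itv/= !lte_fin ab ltr_pM2r ?invr_gt0// ab.
rewrite -!EFinB -EFinM; congr EFin; field; exact: lt0r_neq0.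
Qed.

Lemma ge0_integral_scale (D : set R) (F : R -> \bar R) :
  measurable D -> measurable_fun D F -> (forall x, D x -> 0 <= F x) ->
  \int[leb]_(x in D) F x
  = t%:E * \int[leb]_(x in [set y | D (t * y)%R]) F (t * x)%R.
Proof.
move=> mD mF F0.
transitivity (\int[scaled]_(x in D) F x).
  by apply: eq_measure_integral => A mA _; exact: lebesgue_measure_scale.
rewrite ge0_integral_mscale//; congr (_ * _).
by rewrite ge0_integral_pushforward// => y /[1!inE]; exact: F0.
Qed.

End scaling.

(** The set where [v < w] is a countable union of sets [B a b], with [a < b] rational. Comparing
    integrals over such a set gives [b mu(B) <= a mu(B)], which forces [mu(B) = 0] as [mu] is finite
    on [D]. This also covers functions with infinite integrals. *)
Lemma ae_le_integral d (T : measurableType d) (R : realType)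
    (mu : {measure set T -> \bar R}) (D : set T) (v w : T -> \bar R) :
  measurable D -> mu D < +oo ->
  measurable_fun D v -> measurable_fun D w ->
  (forall x, D x -> 0 <= v x) -> (forall x, D x -> 0 <= w x) ->
  (forall A, measurable A -> A `<=` D ->
    \int[mu]_(x in A) w x <= \int[mu]_(x in A) v x) ->
  {ae mu, forall x, D x -> w x <= v x}.
Proof.
move=> mD finD mv mw v0 w0 wv.
pose B (a b : R) : set T :=
  (D `&` [set x | v x <= a%:E]) `&` (D `&` [set x | b%:E <= w x]).
have mB a b : measurable (B a b).
  apply: measurableI; first exact: emeasurable_fun_infty_c.
  exact: emeasurable_fun_c_infty.
have B0 (a b : R) : (0 <= a)%R -> (a < b)%R -> mu (B a b) = 0.
  move=> a0 ab.
  have BD : B a b `<=` D by move=> x [[]].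
  have finB : mu (B a b) \is a fin_num.
    rewrite ge0_fin_numE//; apply: le_lt_trans finD.
    by apply: le_measure => //; rewrite inE.
  have le_ba : b%:E * mu (B a b) <= a%:E * mu (B a b).
    have h1 : \int[mu]_(x in B a b) (cst b%:E) x <= \int[mu]_(x in B a b) w x.
      apply: le_lower_integral => [x _|x [_ []]//].
      by rewrite lee_fin ltW// (le_lt_trans a0 ab).
    have h2 : \int[mu]_(x in B a b) v x <= \int[mu]_(x in B a b) (cst a%:E) x.
      by apply: le_lower_integral => [x [[/v0]]//|x [[]]].
    rewrite !integral_cst// in h1 h2.
    by apply: le_trans h1 (le_trans _ h2); exact: wv.
  move: le_ba; rewrite -(fineK finB) -!EFinM lee_fin => le_ba; congr EFin.
  apply/eqP; rewrite eq_le fine_ge0// andbT -(@pmulr_rle0 _ (b - a)%R) ?subr_gt0//.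
  by rewrite mulrBl subr_le0.
pose N (k : nat) : set T := if (unpickle k : option (rat * rat)) is Some (q1, q2) then
  if ((0 <= q1)%R && (q1 < q2)%R) then B (ratr q1 : R) (ratr q2 : R) else set0 else set0.
have N0 : mu.-negligible (\bigcup_k N k).
  apply: negligible_bigcup => k; rewrite /N.
  case: unpickle => [[q1 q2]|]; last exact: negligible_set0.
  case: ifPn => [/andP[q10 q12]|_]; last exact: negligible_set0.
  by apply/negligibleP => //; apply: B0; rewrite ?ler0q ?ltr_rat.
apply: negligibleS N0 => x /= /not_implyP[Dx /negP]; rewrite -ltNge => vw.
have vfin : v x \is a fin_num by rewrite ge0_fin_numE ?v0// (lt_le_trans vw)// leey.
have [b' vb bw] : exists2 b : R, v x < b%:E & b%:E <= w x.
  have := w0 x Dx; move: vw; case: (w x) => [r vr _|_ _|//].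
    by exists r.
  by exists (fine (v x) + 1)%R; rewrite ?leey// -{1}(fineK vfin) lte_fin ltrDl.
move: vb; rewrite -(fineK vfin) lte_fin => vb.
have [q2] := rat_in_itvoo vb; rewrite in_itv/= => /andP[vq2 q2b].
have [q1] := rat_in_itvoo vq2; rewrite in_itv/= => /andP[vq1 q12].
have [k kE] : exists k : nat, unpickle k = Some (q1, q2).
  by exists (pickle (q1, q2)); exact: pickleK.
exists k; first by [].
rewrite /N kE.
have -> : (0 <= q1)%R.
  by rewrite -(ler0q R) ltW// (le_lt_trans _ vq1)// fine_ge0// v0.
have -> : (q1 < q2)%R by rewrite -(ltr_rat R).
split; split => //=; first by rewrite -(fineK vfin) lee_fin ltW.
by apply: le_trans bw; rewrite lee_fin ltW.
Qed.

(** * Powers with limiting values and the reverse Young inequality *)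

Section epow.
Context (R : realType).

Lemma epow_ge0 (z : \bar R) (r : R) : 0 <= epow z r.
Proof.
by case: z => [s| |]//=; case: ifP => //= _; rewrite ?lee_fin ?powR_ge0.
Qed.

Lemma measurable_epow (r : R) : measurable_fun setT (fun z : \bar R => epow z r).
Proof.
rewrite (_ : (fun _ => _) = fun z => if z == +oo then (if (r < 0)%R then 0 else +oo)
  else if z == -oo then 0
  else if (r < 0)%R && (z == 0) then +oo else (fine z `^ r)%:E); last first.
  by apply/funext => -[s| |].
apply: measurable_fun_ifT => //; first exact: measurable_fun_eqe.
apply: measurable_fun_ifT => //; first exact: measurable_fun_eqe.
apply: measurable_fun_ifT => //.
  by apply: measurable_and => //; exact: measurable_fun_eqe.
apply/measurable_EFinP; apply: (measurableT_comp (measurable_powR _)).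
exact: fine_measurable.
Qed.

(** The [p] term of the reverse Young inequality is moved to the right: [p < 0] here, so [- p^-1] is
    positive and all terms are nonnegative. In the degenerate cases the right-hand side is infinite
    ([a = 0], or an infinite factor times a positive one) or the left-hand side vanishes
    ([b = 0]). *)
Lemma epow_young (p q : R) (a b : \bar R) :
  (p^-1 + q^-1 = 1)%R -> (0 < q < 1)%R -> 0 <= a -> 0 <= b ->
  (q^-1)%:E * epow b q <= a * b + (- p^-1)%:E * epow a p.
Proof.
move=> pq /andP[q0 q1] a0 b0.
have p'E : (- p^-1 = (1 - q) / q)%R.
  by rewrite -[(p^-1)%R](addrK (q^-1)%R) pq; field; rewrite gt_eqF.
have p'0 : (0 < - p^-1)%R by rewrite p'E divr_gt0 ?subr_gt0.
have p0 : (p < 0)%R by rewrite -invr_lt0 -oppr_gt0.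
have qN0 : (q < 0)%R = false by apply/negbTE; rewrite -leNgt ltW.
have term0 : 0 <= (- p^-1)%:E * epow a p.
  by rewrite mule_ge0 ?epow_ge0// lee_fin ltW.
have [->|a_neq0] := eqVneq a 0.
  by rewrite mul0e add0e /= p0 eqxx/= gt0_muley ?lte_fin// leey.
have {a_neq0} a_gt0 : 0 < a by rewrite lt0e a_neq0.
case: b b0 => [b| |//]; last first.
  by move=> _; rewrite gt0_muley// addye ?leey// gt_eqF// (lt_le_trans _ term0).
rewrite lee_fin => b0.
have [b_eq0|b_neq0] := eqVneq b 0%R.
  rewrite b_eq0 /= qN0 /= powR0 ?gt_eqF// !mule0 add0e.
  exact: term0.
have {b_neq0}b_gt0 : (0 < b)%R by rewrite lt0r b_neq0.
case: a a0 a_gt0 term0 => [a| |//]; last first.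
  move=> _ _ term0; rewrite gt0_mulye ?lte_fin// addye ?leey//.
  by rewrite gt_eqF// (lt_le_trans _ term0).
move=> _; rewrite lte_fin => a_gt0 _ /=.
rewrite p0 qN0 (gt_eqF a_gt0)/= -!EFinM -EFinD lee_fin.
(* Young's inequality for [(a b) ^ q] and [a ^ (- q)] with exponents [1 / q]
   and [1 / (1 - q)] *)
have := @conjugate_powR R ((a * b) `^ q)%R (a `^ (- q))%R (q^-1)%R ((1 - q)^-1)%R.
rewrite !powR_ge0 !invr_gt0 subr_gt0 !invrK subrKC => /(_ isT isT q0 q1 erefl).
have a0 := ltW a_gt0; rewrite -!powRrM mulfV ?gt_eqF// powRr1 ?mulr_ge0//.
rewrite powRM// mulrAC -powRD; last by rewrite (gt_eqF a_gt0) implybT.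
rewrite subrr powRr0 mul1r.
have -> : (- q * (1 - q)^-1 = p)%R.
  rewrite -[p]invrK -[(p^-1)%R]opprK p'E; field.
  by rewrite !gt_eqF// subr_gt0.
move=> H; rewrite p'E -(ler_pM2l q0) mulrDr !mulrA mulfV ?gt_eqF// mul1r.
apply: le_trans H _; rewrite le_eqVlt; apply/orP; left; apply/eqP.
by field; rewrite gt_eqF.
Qed.

End epow.

(** * Measurability of curves and evaluations *)

Lemma bigcapT_measurable_rat d (T : measurableType d) (F : rat -> set T) :
  (forall q, measurable (F q)) -> measurable (\bigcap_q F q).
Proof.
move=> mF; rewrite -[X in measurable X]setCK setC_bigcap.
by apply: measurableC; apply: bigcupT_measurable_rat => q; exact: measurableC.
Qed.

Section distance.
Context {R : realType} {M : topologicalType} (d : M -> M -> R).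
Hypotheses (hd : is_distance d) (hdtop : induces_topology d).
Implicit Types (U : set M) (x y : M).

Lemma distance_ge0 x y : (0 <= d x y)%R.
Proof.
case: hd => d0 ds dt; have := dt x y x; rewrite (ds y x) (d0 x x).2//.
by rewrite -mulr2n pmulrn_lge0.
Qed.

(* The distance to the complement of [U], capped at 1 so that it is also
   meaningful for [U = setT]. *)
Definition codist U x : R :=
  inf [set r : R | r = 1%R \/ exists2 y, ~ U y & r = d x y].

Let codist_lb U x :
  lbound [set r : R | r = 1%R \/ exists2 y, ~ U y & r = d x y] 0%R.
Proof. by move=> r /= [->//|[y _ ->]]; exact: distance_ge0. Qed.

Lemma codist_ge0 U x : (0 <= codist U x)%R.
Proof. by apply: lb_le_inf; [exists 1%R; left|exact: codist_lb]. Qed.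

Lemma codist_le1 U x : (codist U x <= 1)%R.
Proof. by apply: ge_inf; [exists 0%R; exact: codist_lb|left]. Qed.

Lemma codist_le U x y : ~ U y -> (codist U x <= d x y)%R.
Proof. by move=> Uy; apply: ge_inf; [exists 0%R; exact: codist_lb|right; exists y]. Qed.

Lemma codist_eq0 U x : ~ U x -> codist U x = 0%R.
Proof.
move=> Ux; apply/eqP; rewrite eq_le codist_ge0 andbT.
by apply: le_trans (codist_le _ Ux) _; case: hd => d0 _ _; rewrite (d0 x x).2.
Qed.

Lemma codist_gt0 U x : open U -> U x -> (0 < codist U x)%R.
Proof.
move=> oU Ux; have : nbhs x U by exact: open_nbhs_nbhs.
rewrite hdtop => -[e e0 eU]; apply: (@lt_le_trans _ _ (Num.min 1 e)%R).
  by rewrite lt_min ltr01.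
apply: lb_le_inf; first by exists 1%R; left.
move=> r /= [->|[y Uy ->]]; first by rewrite ge_min lexx.
rewrite ge_min; apply/orP; right; rewrite leNgt; apply/negP => dxy.
exact/Uy/eU.
Qed.

Lemma codist_lip U x y : (codist U x <= codist U y + d x y)%R.
Proof.
rewrite -lerBlDr; apply: lb_le_inf; first by exists 1%R; left.
move=> r /= [->|[z Uz ->]]; rewrite lerBlDr.
  by rewrite (le_trans (codist_le1 _ _))// lerDl distance_ge0.
apply: le_trans (codist_le _ Uz) _; rewrite addrC.
by case: hd => _ _; exact.
Qed.

Lemma lipschitz_near (f : M -> R) : (forall x y, (f x <= f y + d x y)%R) ->
  forall x (e : R), (0 < e)%R -> \forall y \near x, (`|f y - f x| < e)%R.
Proof.
move=> fl x e e0; apply/hdtop; exists e => // y /= dxy.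
rewrite ltr_norml; have := fl x y; have := fl y x.
case: hd => _ ds _; rewrite (ds y x); lra.
Qed.

Lemma codist_continuous U : continuous (codist U).
Proof.
move=> x; apply/cvgrPdist_lt => e e0; near=> y; rewrite distrC; near: y.
by apply: lipschitz_near => // y z; exact: codist_lip.
Unshelve. all: by end_near. Qed.

Lemma distance_hausdorff : hausdorff_space M.
Proof.
move=> x y clxy; case: (hd) => d0 ds dt; apply/d0/eqP.
rewrite eq_le distance_ge0 andbT leNgt; apply/negP => dxy.
have e0 : (0 < d x y / 2)%R by rewrite divr_gt0.
have [] := clxy [set z | d x z < d x y / 2]%R [set z | d y z < d x y / 2]%R.
- by apply/hdtop; exists (d x y / 2)%R.
- by apply/hdtop; exists (d x y / 2)%R.
by move=> z /= [xz yz]; have := dt x z y; rewrite (ds z y); lra.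
Qed.

End distance.

Lemma left_continuous_measurable (R : realType) (f : R -> R) :
  (forall t (e : R), (0 < e)%R -> exists2 h : R, (0 < h)%R &
    forall s, (t - h < s)%R -> (s <= t)%R -> (`|f s - f t| < e)%R) ->
  measurable_fun setT f.
Proof.
move=> lf; apply: (measurability _ (RGenOInfty.measurableE R)).
move=> _ [_ [a ->] <-]; rewrite setTI; apply: left_open_measurable => t /=.
rewrite in_itv/= andbT => aft; have e0 : (0 < f t - a)%R by rewrite subr_gt0.
have [h h0 hf] := lf t _ e0; exists h => // s ts st; rewrite in_itv/= andbT.
by have := hf s ts st; rewrite ltr_norml; lra.
Qed.

Section curves.
Context {R : realType} {X : fmm_spacetime R}.
Implicit Types (g h : LCC X) (U : set X).

(** Before 0 and beyond 1 the extended curve is locally constant to the left; on []0, 1]] this is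
    left-continuity together with the value at [t] itself. *)
Lemma lcc_left_near g (t : R) (P : set X) : nbhs (g t) P ->
  exists2 e : R, (0 < e)%R & forall s, (t - e < s)%R -> (s <= t)%R -> P (g s).
Proof.
move=> Pg; case: (lcc_funP g) => _ lg g0 g1.
have [t0|t0] := leP t 0%R.
  exists 1%R => // s _ st; rewrite g0 ?(le_trans st)// -(g0 t)//.
  exact: nbhs_singleton.
have [t1|t1] := leP t 1%R; last first.
  exists (t - 1)%R; first by rewrite subr_gt0.
  move=> s; rewrite subKr => s1 _; rewrite g1 ?ltW// -(g1 t) ?ltW//.
  exact: nbhs_singleton.
have := lg t t0 t1 _ Pg; rewrite /= /nbhs/= => -[e /= e0 eP].
exists e => // s ts; rewrite le_eqVlt => /predU1P[->|st].
  exact: nbhs_singleton.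
by apply: eP => //=; rewrite ltr_distlC; apply/andP; split; lra.
Qed.

Lemma measurable_lcc g : measurable_fun setT (g : R -> borel X).
Proof.
apply: (@measurability _ _ _ (borel X) _ _ (@open X)) => // _ [U oU <-]; rewrite setTI.
apply: left_open_measurable => t /= Ugt.
by apply: lcc_left_near; exact: open_nbhs_nbhs.
Qed.

End curves.

Lemma measurable_continuous_borel (R : realType) (M : ptopologicalType)
    (f : M -> R) :
  continuous f -> measurable_fun setT (f : borel M -> R).
Proof.
move=> /continuousP cf; apply: (measurability _ (RGenOpens.measurableE R)).
move=> _ [_ [a [b ->]] <-]; rewrite setTI.
by apply: sub_sigma_algebra; apply: cf; exact: interval_open.
Qed.

Section evaluation.
Context {R : realType} {X : fmm_spacetime R} {d : X -> X -> R}.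
Hypotheses (hd : is_distance d) (hdtop : induces_topology d).
Implicit Types (g h : LCC X) (U : set X).
Local Notation leb := (@lebesgue_measure R).

Lemma measurable_lcc_distance g h : measurable_fun setT (fun s => d (g s) (h s)).
Proof.
apply: left_continuous_measurable => t e e0.
have e2 : (0 < e / 2)%R by rewrite divr_gt0.
have [a a0 ga] : exists2 a : R, (0 < a)%R & forall s, (t - a < s)%R ->
    (s <= t)%R -> (d (g t) (g s) < e / 2)%R.
  by apply: (lcc_left_near (P := fun x => (d (g t) x < e / 2)%R)); apply/hdtop; exists (e / 2)%R.
have [b b0 hb] : exists2 b : R, (0 < b)%R & forall s, (t - b < s)%R ->
    (s <= t)%R -> (d (h t) (h s) < e / 2)%R.
  by apply: (lcc_left_near (P := fun x => (d (h t) x < e / 2)%R)); apply/hdtop; exists (e / 2)%R.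
exists (Num.min a b); first by rewrite lt_min a0.
move=> s; rewrite ltrBlDr -ltrBlDl lt_min => /andP[sa sb] st.
have {}ga := ga s ltac:(lra) st; have {}hb := hb s ltac:(lra) st.
case: hd => _ ds dt.
have := dt (g s) (g t) (h s); have := dt (g t) (h t) (h s).
have := dt (g t) (g s) (h t); have := dt (g s) (h s) (h t).
rewrite (ds (g s) (g t)) (ds (h s) (h t)) ltr_norml; lra.
Qed.

Definition mean_codist U (a b : R) g : \bar R :=
  \int[leb]_(s in `[a, b]%classic) (codist d U (g s))%:E.

Let measurable_codist U g (D : set R) :
  measurable_fun D (fun s => (codist d U (g s))%:E).
Proof.
apply/measurable_EFinP; apply: measurable_funTS.
apply: (@measurableT_comp _ _ _ _ _ _ (codist d U : borel X -> R)).
  exact: (measurable_continuous_borel (codist_continuous hd hdtop (U := U))).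
exact: measurable_lcc.
Qed.

(** [codist] is 1-Lipschitz for [d] and [[a, b]] lies in [[0, 1]], so [mean_codist] is 1-Lipschitz
    for [lcc_dist] and its strict sublevel sets are open. *)
Lemma measurable_mean_codist U (a b : R) (c : \bar R) :
  (0 <= a)%R -> (a < b)%R -> (b <= 1)%R ->
  measurable ([set g | c <= mean_codist U a b g] : set (lcc_borel d)).
Proof.
move=> a0 ab b1; rewrite -[X in measurable X]setCK; apply: measurableC.
apply: sub_sigma_algebra => g /= /negP; rewrite -ltNge => gc.
have fin : mean_codist U a b g \is a fin_num.
  rewrite ge0_fin_numE; last first.
    by apply: integral_ge0 => s _; rewrite lee_fin codist_ge0.
  apply: (@le_lt_trans _ _ (\int[leb]_(s in `[a, b]%classic) (cst 1%:E) s)).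
    apply: le_lower_integral => s _ /=; rewrite lee_fin ?codist_ge0//.
    exact: codist_le1.
  rewrite integral_cst//= mul1e lebesgue_measure_itv/= lte_fin ab.
  by rewrite -EFinB ltry.
have [e e0 ec] : exists2 e : R, (0 < e)%R & mean_codist U a b g + e%:E <= c.
  case: c gc => [c| |]; last 2 first.
  - by exists 1%R; rewrite ?ltr01 ?leey.
  - by rewrite ltNge leNye.
  rewrite -(fineK fin) lte_fin => gc; exists (c - fine (mean_codist U a b g))%R.
    by rewrite subr_gt0.
  by rewrite -EFinD subrKC.
exists e => // h gh; apply/negP; rewrite -ltNge; apply: lt_le_trans ec.
apply: (@le_lt_trans _ _ (mean_codist U a b g + lcc_dist d g h)); last first.
  by rewrite lteD2lE.
have mdist (D : set R) : measurable_fun D (fun s => (d (g s) (h s))%:E).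
  apply/measurable_EFinP; apply: measurable_funTS.
  exact: measurable_lcc_distance.
have dist0 s : 0 <= (d (g s) (h s))%:E by rewrite lee_fin distance_ge0.
have cod0 k s : 0 <= (codist d U ((k : LCC X) s))%:E by rewrite lee_fin codist_ge0.
apply: (@le_trans _ _ (mean_codist U a b g
    + \int[leb]_(s in `[a, b]%classic) (d (g s) (h s))%:E)).
  rewrite -ge0_integralD//=; [|exact: measurable_codist|exact: mdist].
  apply: le_lower_integral => // s _; rewrite -EFinD lee_fin.
  by case: (hd) => _ ds _; rewrite (ds (g s)); exact: codist_lip.
apply: leeD => //; rewrite /lcc_dist -[X in X <= _]add0e; apply: leeD.
  by rewrite lee_fin distance_ge0.
apply: ge0_subset_integral => //=; first exact: mdist.
by apply: subset_itv; rewrite bnd_simp.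
Qed.

(* For [0 < r <= 1], left-continuity gives [g r \in U] iff the mean values of
   the distance to the complement of [U] over all intervals close enough to
   [r] on its left are bounded below by a positive constant. *)
Let joint_set U (k : nat) (q a b : rat) : set (lcc_borel d * R) :=
  if [&& (0 <= q)%R, (q < a)%R, (a < b)%R & (b <= 1)%R] then
    [set z | (z.2 <= ratr b)%R] `|`
    [set z | ((ratr b - ratr a) / k.+1%:R)%:E <=
             mean_codist U (ratr a) (ratr b) z.1]
  else setT.

Let measurable_joint_set U k q a b : measurable (joint_set U k q a b).
Proof.
rewrite /joint_set; case: ifPn => // /and4P[q0 qa ab b1]; apply: measurableU.
  rewrite (_ : [set _ | _] = setT `&` snd @^-1` `]-oo, ratr b]%classic); last first.
    by rewrite setTI; apply/seteqP; split=> z /=; rewrite in_itv.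
  exact: measurable_snd.
have := @measurable_mean_codist U (ratr a) (ratr b)
  ((ratr b - ratr a) / k.+1%:R)%:E.
rewrite ler0q (le_trans q0 (ltW qa)) ltr_rat ab -[X in (_ <= X)%R](rmorph1 (@ratr R)) ler_rat b1.
move=> /(_ isT isT isT) mF; rewrite -[X in measurable X]setTI.
have := @measurable_fst _ _ (lcc_borel d) R measurableT _ mF; exact.
Qed.

Let joint_setP U (g : LCC X) (r : R) : open U -> (0 < r)%R -> (r <= 1)%R ->
  U (g r) <-> exists k : nat, exists q : rat, [/\ (0 <= q)%R, (ratr q < r)%R &
     forall a b : rat, joint_set U k q a b (g, r)].
Proof.
move=> oU r0 r1; split=> [Ug|[k [q [q0 qr Z]]]].
  have c0 := codist_gt0 hdtop oU Ug.
  have [k kc] : exists k : nat, (k.+1%:R^-1 < codist d U (g r))%R.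
    by have [k _ /(_ k (leqnn k))] := near_infty_natSinv_lt (PosNum c0); exists k.
  have [e e0 eP] : exists2 e : R, (0 < e)%R & forall s, (r - e < s)%R ->
      (s <= r)%R -> (k.+1%:R^-1 < codist d U (g s))%R.
    apply: (lcc_left_near (P := fun x => (k.+1%:R^-1 < codist d U x)%R)).
    apply/hdtop.
    exists (codist d U (g r) - k.+1%:R^-1)%R; first by rewrite subr_gt0.
    move=> y /=; rewrite ltrBrDl => dgy.
    by rewrite -(ltrD2r (d (g r) y)); apply: lt_le_trans dgy (codist_lip hd _ _ _).
  (* For [q] this close to [r], every [[a, b]] inside []q, r[] lies where [codist] exceeds
     [1 / (k + 1)]. *)
  have : (Num.max 0 (r - e) < r)%R by rewrite gt_max r0; lra.
  move=> /rat_in_itvoo[q]; rewrite in_itv/= gt_max => /andP[/andP[q0 qe] qr].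
  exists k, q; split => //; first by rewrite -(ler0q R) ltW.
  move=> a b; rewrite /joint_set; case: ifPn => // /and4P[_ qa ab b1].
  have [rb|rb] := leP r (ratr b); first by left.
  right => /=; rewrite -(ltr_rat R) in qa; rewrite -(ltr_rat R) in ab.
  apply: (@le_trans _ _ (\int[leb]_(s in `[(ratr a : R), ratr b]%classic)
      (cst (k.+1%:R^-1)%:E) s)).
    rewrite integral_cst//= lebesgue_measure_itv/= lte_fin ab.
    by rewrite -EFinB -EFinM mulrC.
  apply: le_lower_integral => s /=; first by rewrite lee_fin.
  rewrite in_itv/= => /andP[sa sb]; rewrite lee_fin ltW//.
  by apply: eP; lra.
apply: contrapT => Ug; have c0 := codist_eq0 hd Ug.
(* Otherwise [codist] vanishes at [g r], so just to the left of [r] it is below half the threshold,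
   and the mean over an interval there contradicts [joint_set]. *)
have k0 : (0 < k.+1%:R^-1 / 2 :> R)%R by rewrite divr_gt0.
have [e e0 eP] : exists2 e : R, (0 < e)%R & forall s, (r - e < s)%R ->
    (s <= r)%R -> (codist d U (g s) < k.+1%:R^-1 / 2)%R.
  apply: (lcc_left_near (P := fun x => (codist d U x < k.+1%:R^-1 / 2)%R)).
  apply/hdtop; exists (k.+1%:R^-1 / 2)%R => // y /= dgy.
  have := codist_lip hd U y (g r); rewrite c0 add0r; case: hd => _ ds _.
  by rewrite (ds y) => /le_lt_trans; exact.
have : (Num.max (ratr q) (r - e) < r)%R by rewrite gt_max qr; lra.
move=> /rat_in_itvoo[a]; rewrite in_itv/= gt_max => /andP[/andP[qa ea] ar].
have [b] := rat_in_itvoo ar; rewrite in_itv/= => /andP[ab br].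
have := Z a b; rewrite /joint_set ifT; last first.
  rewrite q0 -(ltr_rat R) qa -(ltr_rat R) ab/=.
  by rewrite -(ler_rat R) rmorph1 (le_trans _ r1)// ltW.
move=> [|] /=; first by rewrite leNgt br.
apply/negP; rewrite -ltNge.
apply: (@le_lt_trans _ _ (\int[leb]_(s in `[(ratr a : R), ratr b]%classic)
    (cst (k.+1%:R^-1 / 2)%:E) s)).
  apply: le_lower_integral => s /=; first by rewrite lee_fin codist_ge0.
  rewrite in_itv/= => /andP[sa sb]; rewrite lee_fin ltW//.
  by apply: eP; lra.
rewrite integral_cst//= lebesgue_measure_itv/= lte_fin ab.
rewrite -EFinB -EFinM lte_fin mulrC ltr_pM2l ?subr_gt0//.
by rewrite ltr_pdivrMr// ltr_pMr// ltr1n.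
Qed.

(** By [joint_setP], membership in an open set is a countable combination of measurable conditions.
    Measurability in curve and time jointly is what Tonelli's theorem requires later; time 0, which
    has no left neighbourhood in [[0, 1]], is excluded. *)
Lemma measurable_joint_evaluation :
  measurable_fun ([set: lcc_borel d] `*` `]0%R, 1%R]%classic : set (lcc_borel d * R))
    (fun z : lcc_borel d * R => (z.1 : LCC X) z.2 : borel X).
Proof.
apply: (@measurability _ _ _ (borel X) _ _ (@open X)) => // _ [U oU <-].
set D := _ `*` _.
have mD : measurable D by exact: measurableX.
suff -> : D `&` (fun z => (z.1 : LCC X) z.2 : borel X) @^-1` U =
    D `&` \bigcup_k \bigcup_q ((if (0 <= q)%R then setT else set0) `&`
      ([set z : lcc_borel d * R | (ratr q < z.2)%R] `&`
       \bigcap_a \bigcap_b joint_set U k q a b)).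
  apply: measurableI => //; apply: bigcupT_measurable => k.
  apply: bigcupT_measurable_rat => q; apply: measurableI; first by case: ifP.
  apply: measurableI.
    rewrite (_ : [set _ | _] = setT `&` snd @^-1` `]ratr q, +oo[%classic); last first.
      by rewrite setTI; apply/seteqP; split=> z /=; rewrite in_itv/= andbT.
    exact: measurable_snd.
  by do 2 apply: bigcapT_measurable_rat => ?.
apply/seteqP; split=> -[g r] [[_ /=]]; rewrite in_itv/= => /andP[r0 r1].
  move=> Ug; split; first by split => //=; rewrite in_itv/= r0.
  have [k [q [q0 qr Z]]] := (joint_setP g oU r0 r1).1 Ug.
  by exists k => //; exists q => //; rewrite q0; split => //; split => // a _ b _; exact: Z.
move=> [k _ [q _ []]]; case: ifPn => // q0 _ [/= qr Z].
split; first by split => //=; rewrite in_itv/= r0.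
by apply/(joint_setP g oU r0 r1); exists k, q; split => // a b; exact: (Z a I b I).
Qed.

(** At time 0 the evaluation is continuous because [lcc_dist] contains the term [d (g 0) (h 0)]; at
    later times it is a section of the joint evaluation. *)
Lemma measurable_ev (t : R) : (0 <= t)%R -> (t <= 1)%R ->
  measurable_fun setT (ev t : lcc_borel d -> borel X).
Proof.
rewrite le_eqVlt => /predU1P[<- _|t0 t1].
  apply: (@measurability _ _ _ (borel X) _ _ (@open X)) => // _ [U oU <-]; rewrite setTI.
  apply: sub_sigma_algebra => g /= Ug.
  have : nbhs (g 0%R) U by exact: open_nbhs_nbhs.
  rewrite hdtop => -[e e0 eU]; exists e => // h gh; apply: eU => /=.
  rewrite -lte_fin; apply: le_lt_trans gh; rewrite /lcc_dist leeDl//.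
  by apply: integral_ge0 => s _; rewrite lee_fin distance_ge0.
move=> _ A mA; rewrite setTI.
have mD : measurable ([set: lcc_borel d] `*` `]0%R, 1%R]%classic : set (lcc_borel d * R)).
  exact: measurableX.
have := measurable_joint_evaluation mD mA.
move=> /(measurable_ysection t); congr measurable; apply/seteqP; split => g /=.
  by rewrite /ysection/= inE/= => -[].
by move=> Ag; rewrite /ysection/= inE/=; split => //; split => //=; rewrite in_itv/= t0.
Qed.

End evaluation.

(** * From narrow to setwise convergence *)

(** Each point has a neighbourhood of finite measure, hence lies in a ball of finite measure with
    radius [1 / (k + 1)] and centre in the countable dense set. [V n] is the union of the first [n]
    such balls, in an enumeration padded with empty sets. *)
Lemma finite_open_cover (R : realType) (X : fmm_spacetime R) (d : X -> X -> R) :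
  is_distance d -> induces_topology d ->
  exists V : nat -> set X,
    [/\ forall n, open (V n) /\ refm X (V n) < +oo, nondecreasing_seq V
      & \bigcup_n V n = setT].
Proof.
move=> hd hdtop; have [d0 ds dt] := hd.
have [[D cD denseD] _] := carrier_polish X.
have /countable_injP[f finj] := cD.
pose ball k (x : X) := [set y | d x y < k.+1%:R^-1]%R.
have open_ball k x : open (ball k x).
  rewrite openE => y /= xy; apply/hdtop; exists (k.+1%:R^-1 - d x y)%R.
    by rewrite subr_gt0.
  by move=> z /= yz; apply: le_lt_trans (dt x y z) _; rewrite -ltrBrDl.
pose P n k x := [/\ D x, f x = n & refm X (ball k x) < +oo].
pose W n k := \bigcup_(x in P n k) ball k x.
have open_W n k : open (W n k) by apply: bigcup_open => x _; exact: open_ball.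
have fin_W n k : refm X (W n k) < +oo.
  have [[x [Dx fx bx]]|noP] := pselect (exists x, P n k x).
    suff -> : W n k = ball k x by [].
    apply/seteqP; split=> [z [y [Dy fy _]]|z xz]; last by exists x.
    by have -> : y = x by apply: finj; rewrite ?inE// fy fx.
  suff -> : W n k = set0 by rewrite measure0.
  by rewrite -subset0 => z [x Px _]; apply: noP; exists x.
pose W' j := if (unpickle j : option (nat * nat)) is Some (n, k)
  then W n k else set0.
have open_W' j : open (W' j).
  by rewrite /W'; case: unpickle => [[n k]|]; [exact: open_W|exact: open0].
have fin_W' j : refm X (W' j) < +oo.
  by rewrite /W'; case: unpickle => [[n k]|]; [exact: fin_W|rewrite measure0].
pose V n := \big[setU/set0]_(j < n) W' j.
have open_V n : open (V n).
  rewrite /V; elim: n => [|n IH]; first by rewrite big_ord0; exact: open0.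
  by rewrite big_ord_recr; exact: openU.
exists V; split.
- move=> n; split; first exact: open_V.
  elim: n => [|n IH]; first by rewrite /V big_ord0 measure0.
  rewrite /V big_ord_recr/=; apply: (@le_lt_trans _ _ (refm X (V n) + refm X (W' n))).
    by apply: measureU2; apply: sub_sigma_algebra; [exact: open_V|exact: open_W'].
  by rewrite lte_add_pinfty.
- by apply/nondecreasing_seqP => n; apply/subsetPset; rewrite /V big_ord_recr/=; exact: subsetUl.
apply/seteqP; split => // x _.
have [U [oU Ux finU]] : exists U : set X, [/\ open U, U x & refm X U < +oo].
  by have [+ _] := refm_radon X; exact.
have : nbhs x U by exact: open_nbhs_nbhs.
rewrite hdtop => -[e e0 eU].
have e2 : (0 < e / 2)%R by rewrite divr_gt0.
have [k ke] : exists k : nat, (k.+1%:R^-1 < e / 2)%R.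
  by have [k _ /(_ k (leqnn k))] := near_infty_natSinv_lt (PosNum e2); exists k.
have [y [xy Dy]] : ball k x `&` D !=set0.
  apply: denseD => //; exists x => /=.
  by rewrite /ball/= (d0 x x).2.
have [j jE] : exists j : nat, unpickle j = Some (f y, k).
  by exists (pickle (f y, k)); exact: pickleK.
exists j.+1; first by [].
rewrite /V big_ord_recr/=; right; rewrite /W' jE.
exists y; last by rewrite /ball/= ds.
split=> //; apply: le_lt_trans finU; apply: le_measure.
- by rewrite inE; apply: sub_sigma_algebra; exact: open_ball.
- by rewrite inE; apply: sub_sigma_algebra.
move=> z yz; apply: eU => /=; apply: le_lt_trans (dt x y z) _.
rewrite [e]splitr ltrD//; [exact: lt_trans xy ke|exact: lt_trans yz ke].
Qed.

Section setwise_convergence.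
Context {R : realType} {X : fmm_spacetime R} {d : X -> X -> R}.
Hypotheses (hd : is_distance d) (hdtop : induces_topology d).
Variable mu : R -> {measure set (borel X) -> \bar R}.
Hypothesis mu1 : forall r, mu r setT = 1.
Variables T C : R.
Hypotheses (T0 : (0 < T)%R) (C0 : (0 < C)%R).
Hypothesis mu_le : forall r, (0 <= r)%R -> (r <= T)%R ->
  forall A, measurable A -> mu r A <= C%:E * refm X A.
Hypothesis mu_narrow : forall phi : X -> R, continuous phi ->
  (exists K : R, forall x, (`|phi x| <= K)%R) ->
  \int[mu t]_x (phi x)%:E @[t --> (0%R : R)^'+] --> \int[mu 0%R]_x (phi x)%:E.
Local Notation m := (refm X).

Let near_le_T : \forall r \near (0%R : R)^'+, (0 <= r)%R /\ (r <= T)%R.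
Proof.
near=> r; split; near: r; last exact: nbhs_right_le.
by near=> r; apply: ltW; near: r; exact: nbhs_right_gt.
Unshelve. all: by end_near. Qed.

Let measurable_open (U : set X) : open U -> measurable (U : set (borel X)).
Proof. exact: sub_sigma_algebra. Qed.

Let mu_fin r (A : set (borel X)) : measurable A -> mu r A \is a fin_num.
Proof.
move=> mA; rewrite ge0_fin_numE//; apply: (@le_lt_trans _ _ 1); last exact: ltry.
by rewrite -(mu1 r); apply: le_measure; rewrite ?inE//; exact: measurableT.
Qed.

(** One half of the portmanteau theorem: the bounded continuous functions [phi k] lie below the
    indicator of [U] and equal 1 on sets [F k] that increase to [U]. *)
Lemma open_lower_semicontinuous (U : set X) (c : \bar R) : open U ->
  c < mu 0%R U -> \forall r \near (0%R : R)^'+, c < mu r U.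
Proof.
move=> oU cU.
pose phi (k : nat) x : R := (Num.min 1 (k.+1%:R * codist d U x))%R.
have cphi k : continuous (phi k).
  move=> x; apply: (@continuous_min _ _ (cst 1%R) (fun x => k.+1%:R * codist d U x)%R).
    exact: cvg_cst.
  by apply: cvgM; [exact: cvg_cst|exact: codist_continuous].
have phi01 k x : (0 <= phi k x <= 1)%R.
  by rewrite /phi ge_min lexx/= le_min ler01/= mulr_ge0// codist_ge0.
pose F (k : nat) : set X := [set x | 1 <= phi k x]%R.
have mphi k : measurable_fun setT (phi k : borel X -> R).
  exact: measurable_continuous_borel.
have mF k : measurable (F k : set (borel X)).
  rewrite (_ : F k = setT `&` phi k @^-1` `[1%R, +oo[%classic).
    exact: mphi.
  by rewrite setTI; apply/seteqP; split => x /=; rewrite in_itv/= andbT.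
have UF : \bigcup_k F k = U.
  apply/seteqP; split=> [x [k _ /=]|x Ux].
    rewrite /F/= /phi le_min lexx/= => h; apply: contrapT => Ux.
    by move: h; rewrite (codist_eq0 hd Ux) mulr0 ler10.
  have c0 := codist_gt0 hdtop oU Ux.
  have [k kc] : exists k : nat, (k.+1%:R^-1 < codist d U x)%R.
    by have [k _ /(_ k (leqnn k))] := near_infty_natSinv_lt (PosNum c0); exists k.
  exists k => //=; rewrite /F/= /phi le_min lexx/= mulrC -ler_pdivrMr// mul1r.
  exact: ltW.
have ndF : nondecreasing_seq F.
  apply/nondecreasing_seqP => k; apply/subsetPset => x.
  rewrite /F/= /phi !le_min !lexx/= => /le_trans; apply; rewrite ler_wpM2r ?codist_ge0//.
  by rewrite ler_nat.
have : mu 0%R \o F @ \oo --> mu 0%R U.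
  rewrite -[in X in _ --> X]UF; apply: nondecreasing_cvg_mu => //.
  by rewrite UF; exact: measurable_open.
move=> /(_ _ (open_ereal_gt' cU))[k _ /(_ k (leqnn k))/= ck].
have bnd : exists K : R, forall x, (`|phi k x| <= K)%R.
  by exists 1%R => x; have /andP[p0 p1] := phi01 k x; rewrite ger0_norm.
have : c < \int[mu 0%R]_x (phi k x)%:E.
  apply: lt_le_trans ck _; rewrite -[X in mu _ X]setIT -(@integral_indic _ _ _ (mu 0%R) _ measurableT)//.
  apply: le_lower_integral => x _; rewrite lee_fin ?indic_ge0//.
  rewrite indicE; have [|_] := boolP (x \in F k); last by have /andP[] := phi01 k x.
  by rewrite inE.
move=> /open_ereal_gt' cphi0.
have : \forall r \near (0%R : R)^'+, c < \int[mu r]_x (phi k x)%:E.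
  exact: (mu_narrow (cphi k) bnd cphi0).
apply: filterS => r /= cr.
apply: lt_le_trans cr _; rewrite -[X in mu _ X]setIT.
rewrite -(@integral_indic _ _ _ (mu r) _ measurableT); last exact: measurable_open.
apply: le_lower_integral => x _; rewrite lee_fin; have /andP[p0 p1] := phi01 k x => //.
rewrite indicE; have [//|] := boolP (x \in U); rewrite notin_setE => Ux.
by rewrite /phi (codist_eq0 hd Ux) mulr0 minEle ler10.
Qed.

(** In a part [B] of [A] of finite measure, take a compact [K], and around [K] an open [G n], with
    [B] and [G n] exceeding [K] by less than [e / C] in reference measure. The bound [mu r <= C m]
    turns this into errors of at most [e], uniformly in small [r]. *)
Lemma lower_semicontinuous_setwise (A : set (borel X)) (c : \bar R) :
  measurable A -> c < mu 0%R A -> \forall r \near (0%R : R)^'+, c < mu r A.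
Proof.
move=> mA; case: c => [c||]; last 2 first.
- by rewrite ltNge leey.
- move=> _; near=> r; apply: (@lt_le_trans _ _ 0) => //; exact: ltNyr.
move=> cA.
have [V [oV ndV VT]] := finite_open_cover hd hdtop.
have mV n : measurable (V n : set (borel X)) by apply: measurable_open; exact: (oV n).1.
have : mu 0%R \o (fun n => A `&` V n) @ \oo --> mu 0%R A.
  rewrite -[in X in _ --> X](setIT A) -VT setI_bigcupr.
  apply: nondecreasing_cvg_mu => [n||].
  - exact: measurableI.
  - by rewrite -setI_bigcupr VT setIT.
  - apply/nondecreasing_seqP => n; apply/subsetPset; apply: setIS.
    by apply/subsetPset; exact/(nondecreasing_seqP _).2.
move=> /(_ _ (open_ereal_gt' cA))[N _ /(_ N (leqnn N))/=].
set B := A `&` V N => cB.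
have mB : measurable B by exact: measurableI.
have finB : m B < +oo.
  by apply: le_lt_trans (oV N).2; apply: le_measure; rewrite ?inE//; exact: subIsetr.
(* One [e] is lost from [B] to [K] at time 0, the other from [G n] back to [K] at time [r]. *)
have {cB} : exists2 e : R, (0 < e)%R & (c + e + e)%:E < mu 0%R B.
  have f0 := mu_fin 0 mB; move: cB; rewrite -(fineK f0) lte_fin => cB.
  exists ((fine (mu 0%R B) - c) / 3)%R; first by rewrite divr_gt0 ?subr_gt0.
  by rewrite lte_fin; lra.
move=> [e e0 ceB].
pose e' := (e / C)%R; have e'0 : (0 < e')%R by rewrite divr_gt0.
have Ce' : C%:E * e'%:E = e%:E by rewrite -EFinM mulrCA mulfV ?gt_eqF// mulr1.
have mBfin : m B \is a fin_num by rewrite ge0_fin_numE.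
have [K [cK KB] mBK] : exists2 K : set X, compact K /\ K `<=` B & m B < m K + e'%:E.
  have : m B - e'%:E < m B by rewrite lteBlDr// lteDl// lte_fin.
  have [_ /(_ _ mB) {2}->] := refm_radon X.
  by move=> /ereal_sup_gt[_ [K HK <-]]; rewrite lteBlDr// => ?; exists K.
have clK : closed K by exact/(compact_closed (distance_hausdorff hd hdtop)).
have mK : measurable (K : set (borel X)).
  by rewrite -[K]setCK; apply: measurableC; apply: measurable_open; exact: closed_openC.
have Kfin : m K \is a fin_num.
  by rewrite ge0_fin_numE// (le_lt_trans _ finB)//; apply: le_measure; rewrite ?inE.
have le_diff (r : R) (Q : set (borel X)) : (0 <= r)%R -> (r <= T)%R ->
    measurable Q -> K `<=` Q -> m Q < m K + e'%:E -> mu r Q <= mu r K + e%:E.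
  move=> r0 rT mQ KQ QK; rewrite (measureDI (mu r) mQ mK).
  rewrite (_ : Q `&` K = K); last by apply/seteqP; split => [x []|x Kx]//; split => //; exact: KQ.
  rewrite addeC leeD2l// -Ce'; apply: le_trans (mu_le r0 rT (measurableD mQ mK)) _.
  rewrite lee_pmul2l ?lte_fin//.
  rewrite measureD//; last by rewrite (lt_trans QK)// lte_add_pinfty// ?ltry// -ge0_fin_numE.
  rewrite (_ : Q `&` K = K); last by apply/seteqP; split => [x []|x Kx]//; split => //; exact: KQ.
  by rewrite leeBlDl// ltW.
have cK0 : (c + e)%:E < mu 0%R K.
  have := le_diff 0%R B (lexx _) (ltW T0) mB KB mBK.
  by move=> /(lt_le_trans ceB); rewrite EFinD lteD2rE.
(* Intersecting with [V N] keeps the measures finite, so that [m (G n)] decreases to [m K]. *)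
pose G (n : nat) := V N `&` [set x | codist d (~` K) x < n.+1%:R^-1]%R.
have oG n : open (G n).
  apply: openI; first exact: (oV N).1.
  rewrite (_ : [set _ | _] = codist d (~` K) @^-1` `]-oo, (n.+1%:R^-1)%R[%classic); last first.
    by apply/seteqP; split => x /=; rewrite in_itv.
  by have /continuousP := codist_continuous hd hdtop (U := ~` K); apply; exact: interval_open.
have KG n : K `<=` G n.
  move=> x Kx; split; first by have [] := KB _ Kx.
  by rewrite /= (codist_eq0 hd)//= invr_gt0.
have GK : \bigcap_n G n = K.
  apply/seteqP; split=> [x Gx|x Kx n _]; last exact: KG.
  apply: contrapT => Kx.
  have c0 := codist_gt0 hdtop (closed_openC clK) Kx.
  have [k kc] : exists k : nat, (k.+1%:R^-1 < codist d (~` K) x)%R.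
    by have [k _ /(_ k (leqnn k))] := near_infty_natSinv_lt (PosNum c0); exists k.
  by have [_ /=] := Gx k I; rewrite ltNge ltW.
have : m \o G @ \oo --> m K.
  rewrite -[in X in _ --> X]GK; apply: nonincreasing_cvg_mu.
  - apply: le_lt_trans (oV N).2; apply: le_measure; rewrite ?inE//.
    + exact: measurable_open.
    + by move=> x [].
  - by move=> n; exact: measurable_open.
  - by rewrite GK.
  apply/nonincreasing_seqP => n; apply/subsetPset; apply: setIS => x /=.
  by move=> /lt_le_trans; apply; rewrite lef_pV2 ?posrE// ler_nat.
have KKe : m K < m K + e'%:E by rewrite lteDl// lte_fin.
move=> /(_ _ (open_ereal_lt' KKe))[n _ /(_ n (leqnn n))/= Gn].
have cG : (c + e)%:E < mu 0%R (G n).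
  apply: lt_le_trans cK0 _; apply: le_measure; rewrite ?inE//.
  exact: measurable_open.
have := open_lower_semicontinuous (oG n) cG; apply: filterS2 near_le_T => r [r0 rT] cr.
have := le_diff r _ r0 rT (measurable_open (oG n)) (@KG n) Gn.
move=> /(lt_le_trans cr); rewrite EFinD lteD2rE// => /lt_le_trans; apply.
by apply: le_measure; rewrite ?inE// => x /KB[].
Unshelve. all: by end_near. Qed.

(** All [mu r] have total mass 1, so lower bounds on the complement are upper bounds on [A]. *)
Lemma cvg_setwise (A : set (borel X)) : measurable A ->
  mu r A @[r --> (0%R : R)^'+] --> mu 0%R A.
Proof.
move=> mA; have mCA : measurable (~` A) by exact: measurableC.
have muC r : mu r A = 1 - mu r (~` A).
  rewrite -(mu1 r) -(setUv A) measureU// ?addeK ?mu_fin//.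
  by rewrite setICr.
rewrite -(fineK (mu_fin 0 mA)); apply/fine_cvgP; split.
  by near=> r; exact: mu_fin.
apply/cvgrPdist_lt => e e0; near=> r.
have l1 : (fine (mu 0%R A) - e)%:E < mu r A.
  near: r; apply: lower_semicontinuous_setwise => //.
  by rewrite -[X in _ < X](fineK (mu_fin 0 mA)) lte_fin gtrBl.
have l2 : (fine (mu 0%R (~` A)) - e)%:E < mu r (~` A).
  near: r; apply: lower_semicontinuous_setwise => //.
  by rewrite -[X in _ < X](fineK (mu_fin 0 mCA)) lte_fin gtrBl.
move: l1 l2; rewrite /= !muC -(fineK (mu_fin r mCA)) -(fineK (mu_fin 0 mCA)).
rewrite -!EFinB !lte_fin/= ltr_norml; lra.
Unshelve. all: by end_near. Qed.

Lemma cvg_sintegral_setwise (h : {nnsfun (borel X) >-> R}) :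
  sintegral (mu r) h @[r --> (0%R : R)^'+] --> sintegral (mu 0%R) h.
Proof.
under eq_fun do rewrite sintegralE fsbig_finite//=.
rewrite sintegralE fsbig_finite//=; apply: cvg_nnesum => y _.
  by near=> r; exact: nnsfun_mulemu_ge0.
by apply: cvgeZl => //; exact: cvg_setwise.
Unshelve. all: by end_near. Qed.

Lemma integral_lower_semicontinuous (g : X -> \bar R) (c : \bar R) :
  (forall x, 0 <= g x) -> c < \int[mu 0%R]_x g x ->
  \forall r \near (0%R : R)^'+, c < \int[mu r]_x g x.
Proof.
move=> g0; rewrite ge0_integralTE// => /ereal_sup_gt[_ [h /= hg <-] ch].
have : \forall r \near (0%R : R)^'+, c < sintegral (mu r) h.
  exact: (cvg_sintegral_setwise (open_ereal_gt' ch)).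
apply: filterS => r /= cr.
apply: lt_le_trans cr _; rewrite ge0_integralTE//.
by apply: ereal_sup_ubound; exists h.
Qed.

(** For small [r] the restriction [g'] of [g] to [E] has the same [mu r]-integral as [g]. A simple
    [h] below [g'] is chosen so that the remainder [w] has reference integral at most [e / C], hence
    [mu r]-integral at most [e], while the integrals of [h] converge. *)
Lemma integral_upper_semicontinuous (E : set (borel X)) (T' : R)
    (g : X -> \bar R) (c : \bar R) :
  measurable E -> (0 < T')%R ->
  (forall r, (0 <= r)%R -> (r <= T')%R -> mu r (~` E) = 0) ->
  measurable_fun setT (g : borel X -> \bar R) -> (forall x, 0 <= g x) ->
  \int[m]_(x in E) g x < +oo -> \int[mu 0%R]_x g x < c ->
  \forall r \near (0%R : R)^'+, \int[mu r]_x g x < c.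
Proof.
move=> mE T'0 muE mg g0 gE gc.
have near_le_T' : \forall r \near (0%R : R)^'+, (0 <= r)%R /\ (r <= T')%R.
  near=> r; split; near: r; last exact: nbhs_right_le.
  by near=> r; apply: ltW; near: r; exact: nbhs_right_gt.
pose g' := g \_ E.
have g'0 x : 0 <= g' x by apply: erestrict_ge0.
have mg' : measurable_fun setT (g' : borel X -> \bar R).
  by apply/(measurable_restrictT _ _).1 => //; exact: measurable_funTS.
have g'E r : (0 <= r)%R -> (r <= T')%R -> \int[mu r]_x g x = \int[mu r]_x g' x.
  move=> r0 rT; apply: ge0_ae_eq_integral => //.
  exists (~` E); split; [exact: measurableC|exact: muE|].
  move=> x /= /not_implyP[_ gg'] Ex; apply: gg'.
  by rewrite /g' patchE mem_set.
have ig'fin : \int[m]_x g' x \is a fin_num.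
  by rewrite ge0_fin_numE ?integral_ge0// -integral_mkcond.
rewrite (g'E _ (lexx _) (ltW T'0)) in gc.
have [e e0 gec] : exists2 e : R, (0 < e)%R & \int[mu 0%R]_x g' x + e%:E + e%:E < c.
  have fin0 : \int[mu 0%R]_x g' x \is a fin_num.
    by rewrite ge0_fin_numE ?integral_ge0// (lt_le_trans gc)// leey.
  move: gc; rewrite -(fineK fin0); case: c => [c gc|_|]; last by rewrite ltNge leNye.
    exists ((c - fine (\int[mu 0%R]_x g' x)) / 3)%R.
      by rewrite divr_gt0// subr_gt0.
    by rewrite -!EFinD lte_fin; move: gc; rewrite lte_fin; lra.
  by exists 1%R; rewrite // -!EFinD ltry.
pose e' := (e / C)%R; have e'0 : (0 < e')%R by rewrite divr_gt0.
have Ce' : C%:E * e'%:E = e%:E by rewrite -EFinM mulrCA mulfV ?gt_eqF// mulr1.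
have [h hg' hI] : exists2 h : {nnsfun (borel X) >-> R},
    (forall x, (h x)%:E <= g' x) & \int[m]_x g' x < sintegral m h + e'%:E.
  have : \int[m]_x g' x - e'%:E < \int[m]_x g' x by rewrite lteBlDr// lteDl// lte_fin.
  rewrite {2}ge0_integralTE// => /ereal_sup_gt[_ [h hg' <-]].
  by rewrite lteBlDr// => ?; exists h.
pose w (x : borel X) := g' x - (h x)%:E.
have mh : measurable_fun setT (fun x => (h x)%:E) by exact/measurable_EFinP.
have w0 x : 0 <= w x by rewrite /w sube_ge0// hg'.
have mw : measurable_fun setT w by exact: emeasurable_funB.
have h0 x : 0 <= (h x)%:E by rewrite lee_fin.
have split_int (nu : {measure set (borel X) -> \bar R}) :
    \int[nu]_x g' x = sintegral nu h + \int[nu]_x w x.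
  rewrite -integralT_nnsfun -ge0_integralD//.
  apply: eq_integral => x _; rewrite addeC; exact/esym/subeK.
have shfin : sintegral m h \is a fin_num.
  rewrite ge0_fin_numE ?sintegral_ge0//; apply: le_lt_trans gE.
  rewrite integral_mkcond -/g' split_int leeDl//.
  exact: integral_ge0.
have w_le r : (0 <= r)%R -> (r <= T)%R -> \int[mu r]_x w x <= e%:E.
  move=> r0 rT.
  apply: (@le_trans _ _ (\int[mscale (NngNum (ltW C0)) m]_x w x)).
    by apply: ge0_le_measure_integral => // A mA; exact: mu_le.
  rewrite ge0_integral_mscale//= -Ce' lee_pmul2l ?lte_fin//.
  by move: hI; rewrite split_int lteD2lE// => /ltW.
have hc : sintegral (mu 0%R) h < c - e%:E.
  rewrite lteBrDr//; apply: le_lt_trans gec.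
  rewrite leeD2r// split_int -addeA leeDl// adde_ge0 ?integral_ge0// lee_fin ltW//.
have : \forall r \near (0%R : R)^'+, sintegral (mu r) h < c - e%:E.
  exact: (cvg_sintegral_setwise (open_ereal_lt' hc)).
apply: filterS3 near_le_T near_le_T' => r [r0 rT] [_ rT'] /= hr.
rewrite g'E// split_int; apply: le_lt_trans (leeD2l _ (w_le r r0 rT)) _.
by move: hr; rewrite EFinN lteBrDr.
Unshelve. all: by end_near. Qed.

End setwise_convergence.

(** * Restriction of curves *)

(** For equal infinite values the convention gives [+oo]. *)
Lemma ediff_ge0 (R : realType) (x y : \bar R) : y <= x -> 0 <= ediff x y.
Proof.
rewrite /ediff; case: x y => [a| |] [b| |]//=; rewrite ?leey//.
by rewrite !lee_fin subr_ge0.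
Qed.

Section restriction.
Context {R : realType} {X : fmm_spacetime R}.
Variable t : R.
Hypotheses (t0 : (0 < t)%R) (t1 : (t <= 1)%R).
Implicit Types g h : LCC X.
Local Notation leb := (@lebesgue_measure R).

Lemma ge0_integral_scale_unit (F : R -> \bar R) :
  measurable_fun (`]0%R, t[%classic : set R) F ->
  (forall r, (0 < r)%R -> (r < t)%R -> 0 <= F r) ->
  \int[leb]_(r in `]0%R, t[%classic) F r
  = t%:E * \int[leb]_(s in `]0%R, 1%R[%classic) F (t * s)%R.
Proof.
move=> mF F0; rewrite (ge0_integral_scale t0)//; last first.
  by move=> r; rewrite /= in_itv/= => /andP[]; exact: F0.
rewrite (_ : [set y | _] = `]0%R, 1%R[%classic)//.
by apply/seteqP; split=> s /=; rewrite !in_itv/= pmulr_rgt0// gtr_pMr.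
Qed.

(** The cap [Num.min s 1] keeps the representative constant beyond time 1. *)
Lemma is_lcc_restrict g : is_lcc (fun s : R => g (t * Num.min s 1)%R).
Proof.
have [cg lg g0 g1] := lcc_funP g; split.
- move=> s s' s0 ss' s'1; rewrite (min_l (le_trans ss' s'1)) (min_l s'1).
  apply: cg; first by rewrite mulr_ge0// ltW.
    by rewrite ler_pM2l.
  by rewrite mulr_ile1// ?(ltW t0)//; exact: le_trans s0 ss'.
- move=> s s0 s1 P /= Pg; have [e e0 eP] := lcc_left_near Pg.
  suff : \forall s' \near s^'-, P (g (t * Num.min s' 1)%R) by [].
  near=> s'; have s's : (s' < s)%R by near: s'; exact: nbhs_left_lt.
  have s'e : (s - e / t < s')%R.
    by near: s'; apply: nbhs_left_gt; rewrite ltrBlDr ltrDl divr_gt0.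
  have s'1 : (s' <= 1)%R by rewrite (le_trans (ltW s's)).
  apply: eP; rewrite !min_l//; last by rewrite ler_pM2l// ltW.
  by move: s'e; rewrite -(ltr_pM2l t0) mulrBr mulrCA mulfV ?gt_eqF// mulr1.
- move=> s s0; rewrite !min_l ?ler01//; last by rewrite (le_trans s0)// ler01.
  by rewrite mulr0 g0// pmulr_rle0.
- by move=> s s1; rewrite min_r// min_l.
Unshelve. all: by end_near. Qed.

Definition lcc_restrict g : LCC X := MkLCC (is_lcc_restrict g).

Lemma lcc_restrictE g (s : R) : (s <= 1)%R -> lcc_restrict g s = g (t * s)%R.
Proof. by move=> s1 /=; rewrite min_l. Qed.

Let mul_unit (s : R) : (0 <= s)%R -> (s <= 1)%R ->
  (0 <= t * s)%R /\ (t * s <= 1)%R.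
Proof.
move=> s0 s1; split; first by rewrite mulr_ge0// ltW.
by rewrite mulr_ile1// ltW.
Qed.

Section measures.
Let unscale (x : R) : R := (t^-1 * x)%R.
Let measurable_unscale : measurable_fun setT unscale.
Proof. exact: measurable_funM. Qed.
Let I0t : measurable (`]0%R, t[%classic : set R) := measurable_itv _.
(** The image of [nu] on []0, t[] under [r |-> r / t]; cutting down to []0, t[] leaves no mass
    outside [[0, 1]]. *)
Let blowup (nu : {measure set R -> \bar R}) : {measure set R -> \bar R} :=
  image_measure (mrestr nu I0t) measurable_unscale.

Let blowupE nu A : blowup nu A = nu ([set x | A (t^-1 * x)%R] `&` `]0%R, t[).
Proof. by []. Qed.

Let measurable_preimage (A : set R) : measurable A ->
  measurable [set x : R | A (t^-1 * x)%R].
Proof. by move=> mA; rewrite -[X in measurable X]setTI; exact: measurable_unscale. Qed.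

Let admissible_blowup g nu : admissible g nu ->
  admissible (lcc_restrict g) (blowup nu).
Proof.
move=> [_ nu_le]; split.
  rewrite blowupE (_ : _ `&` _ = set0) ?measure0// -subset0 => x /= [].
  rewrite !in_itv/= => xN /andP[x0 xt]; apply: xN.
  rewrite mulr_ge0 ?invr_ge0 ?(ltW t0) ?(ltW x0)//=.
  by rewrite mulrC ler_pdivrMr// mul1r ltW.
move=> a b a0 ab b1; rewrite !lcc_restrictE//; last exact: le_trans (ltW ab) b1.
rewrite blowupE; apply: le_trans (nu_le _ _ _ _ _); last 3 first.
- by rewrite mulr_ge0// ltW.
- by rewrite ltr_pM2l.
- by have [|] := @mul_unit b _ b1; first exact: le_trans a0 (ltW ab).
apply: le_measure; rewrite ?inE//.
  by apply: measurableI => //; apply: measurable_preimage; exact: measurable_itv.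
move=> x /= [+ _]; rewrite !in_itv/= => /andP[ax xb]; apply/andP; split.
  by rewrite mulrC -ltr_pdivlMr// mulrC.
by rewrite mulrC -ltr_pdivrMr// mulrC.
Qed.

Let ac_blowup (al : {measure set R -> \bar R}) :
  al `<< (leb : set R -> \bar R) -> blowup al `<< (leb : set R -> \bar R).
Proof.
move=> alac N N0 A mA AN; have A0 : leb A = 0 by exact: N0.
rewrite blowupE; apply/eqP; rewrite eq_le measure_ge0 andbT.
have mpA := measurable_preimage mA.
have <- : al [set x | A (t^-1 * x)%R] = 0.
  apply: (alac [set x | A (t^-1 * x)%R]) => // B mB BA.
  apply/eqP; rewrite eq_le measure_ge0 andbT.
  have ti0 : (0 < t^-1)%R by rewrite invr_gt0.
  have <- : leb [set x | A (t^-1 * x)%R] = 0.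
    have := lebesgue_measure_scale ti0 mA; rewrite A0 => /esym/eqP.
    by rewrite mule_eq0 eqe gt_eqF//= => /eqP.
  by apply: le_measure; rewrite ?inE.
by apply: le_measure; rewrite ?inE//; exact: measurableI.
Qed.

(* The blow-up of the largest admissible measure of [g] is admissible for the
   restricted curve, and the blow-up of its absolutely continuous part lies
   below the absolutely continuous part for the restricted curve. *)
Lemma causal_speed_restrict g (v v' : R -> \bar R) :
  is_causal_speed g v -> is_causal_speed (lcc_restrict g) v' ->
  {ae leb, forall s, `]0%R, 1%R[%classic s -> t%:E * v (t * s)%R <= v' s}.
Proof.
move=> [mv v0 [nu [al [[adm _] [[alac alnu] _] alE]]]].
move=> [mv' v'0 [nu' [al' [[_ max'] [_ maxal'] al'E]]]].
have ble A : measurable A -> blowup al A <= al' A.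
  apply: maxal'; split; first exact: ac_blowup.
  move=> B mB; apply: (@le_trans _ _ (blowup nu B)).
    by rewrite !blowupE; apply: alnu; apply: measurableI => //; exact: measurable_preimage.
  exact: (max' (blowup nu) (admissible_blowup adm)).
have mvt : measurable_fun (`]0%R, 1%R[%classic : set R) (fun s => v (t * s)%R).
  have mI : measurable (`[0%R, 1%R]%classic : set R) by exact: measurable_itv.
  apply: (measurable_comp mI _ mv); last exact: measurable_funM.
  move=> _ [s + <-]; rewrite /= !in_itv/= => /andP[s0 s1].
  by have [-> ->] := mul_unit (ltW s0) (ltW s1).
have sub01 (A : set R) : A `<=` `]0%R, 1%R[%classic -> A `<=` `[0%R, 1%R]%classic.
  by move=> A01 x /A01; exact: subset_itv_oo_cc.
have v0t s : `]0%R, 1%R[%classic s -> 0 <= v (t * s)%R.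
  rewrite /= in_itv/= => /andP[s0 s1].
  by have [? ?] := mul_unit (ltW s0) (ltW s1); exact: v0.
apply: ae_le_integral => //.
- by rewrite /= lebesgue_measure_itv/= lte_fin ltr01 -EFinB ltry.
- by apply: measurable_funS mv' => //; exact: sub01.
- exact: measurable_funeM.
- by move=> s /= /[!in_itv]/= /andP[s0 s1]; apply: v'0; exact: ltW.
- by move=> s s01; rewrite mule_ge0 ?v0t// lee_fin ltW.
(* The integral of [t v (t s)] over [A] is [al (t A)], that is [blowup al A], and this is at most
   [al' A], the integral of [v'] over [A]. *)
move=> A mA A01; rewrite -al'E//; last exact: sub01.
apply: le_trans (ble A mA); rewrite blowupE setIidl; last first.
  move=> x /A01; rewrite /= !in_itv/= => /andP[x0 x1]; apply/andP; split.
    by move: x0; rewrite pmulr_rgt0// invr_gt0.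
  by move: x1; rewrite mulrC ltr_pdivrMr// mul1r.
have mpA := measurable_preimage mA.
have pA01 : [set x | A (t^-1 * x)%R] `<=` `[0%R, 1%R]%classic.
  move=> x /A01; rewrite /= !in_itv/= => /andP[x0 x1].
  have -> : x = (t * (t^-1 * x))%R by rewrite mulrA mulfV ?gt_eqF// mul1r.
  by have [-> ->] := mul_unit (ltW x0) (ltW x1).
rewrite alE// (ge0_integral_scale t0)//; last 2 first.
- exact: measurable_funS mv.
- by move=> x /pA01; rewrite /= in_itv/= => /andP[]; exact: v0.
rewrite (_ : [set y | _] = A); last first.
  by apply/funext => s; rewrite /= mulrA mulVf ?gt_eqF// mul1r.
rewrite ge0_integralZl_EFin//.
- by move=> s /A01/v0t.
- exact: measurable_funS mvt.
- exact: ltW.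
Qed.

End measures.

Section test_plans.
Context {d : X -> X -> R}.
Hypotheses (hd : is_distance d) (hdtop : induces_topology d).

(** The change of variables multiplies the integral term by [1 / t], so restriction is Lipschitz
    with constant [1 / t] for [lcc_dist], hence continuous. *)
Lemma measurable_lcc_restrict :
  measurable_fun setT (lcc_restrict : lcc_borel d -> lcc_borel d).
Proof.
apply: (@measurability _ _ _ (lcc_borel d) _ _ (lcc_open d)) => // _ [U oU <-].
rewrite setTI; apply: sub_sigma_algebra => g /= Ug.
have [e e0 eU] := oU _ Ug; exists (t * e)%R; first exact: mulr_gt0.
move=> h gh; apply: eU; rewrite -(@lte_pmul2l _ t%:E) ?lte_fin//.
apply: le_lt_trans gh; rewrite /lcc_dist ge0_muleDr; last 2 first.
- by rewrite lee_fin distance_ge0.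
- by apply: integral_ge0 => s _; rewrite lee_fin distance_ge0.
have mdist k k' (D : set R) :
    measurable_fun D (fun s => (d ((k : LCC X) s) ((k' : LCC X) s))%:E).
  by apply/measurable_EFinP/measurable_funTS; exact: measurable_lcc_distance.
apply: leeD.
  rewrite !lcc_restrictE// mulr0 -EFinM lee_fin ler_piMl// distance_ge0//.
rewrite (@integral_itv_bndoo _ 0%R 1%R _ true false); last exact: mdist.
under eq_integral => s.
  rewrite inE/= in_itv/= => /andP[_ s1]; rewrite !(min_l (ltW s1)); over.
rewrite -(@ge0_integral_scale_unit (fun r => (d (g r) (h r))%:E)); last 2 first.
- exact: mdist.
- by move=> r _ _; rewrite lee_fin distance_ge0.
apply: ge0_subset_integral => //=.
- exact: mdist.
- by move=> s _; rewrite lee_fin distance_ge0.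
- move=> s /=; rewrite !in_itv/= => /andP[s0 st]; rewrite (ltW s0)/=.
  exact: le_trans (ltW st) t1.
Qed.

Let rho : lcc_borel d -> lcc_borel d := lcc_restrict.

#[local] HB.instance Definition _ :=
  isMeasurableFun.Build _ _ _ _ rho measurable_lcc_restrict.

(** The image of [pi] under restriction is a test plan, as its evaluation at [s] is that of [pi] at
    [t s]. From [pi] to its image, upper integrals can only grow and lower ones only shrink, which
    is the direction required at each end of the weak subslope inequality. *)
Lemma weak_subslope_initial (speed : LCC X -> R -> \bar R)
    (pi : probability (lcc_borel d) R) (f G : X -> \bar R) (C : R) :
  (forall g, is_causal_speed g (speed g)) ->
  (0 < C)%R ->
  (forall r, (0 <= r)%R -> (r <= t)%R -> bounded_compression pi r C) ->
  causal_function f -> weak_subslope d speed f G ->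
  upper_integral pi (fun g : LCC X =>
    \int[leb]_(r in `]0%R, t[%classic) (G (g r) * speed g r))
  <= \int[pi]_g ediff (f ((g : LCC X) t)) (f ((g : LCC X) 0%R)).
Proof.
move=> hspeed C0 bc [_ fc] [mG G0 subG].
have mGg g : measurable_fun setT (fun s => G (g s)).
  exact: (measurableT_comp mG (measurable_lcc g)).
have speed0 g s : (0 <= s)%R -> (s <= 1)%R -> 0 <= speed g s.
  by have [_ + _] := hspeed g; exact.
have mspeed g : measurable_fun (`]0%R, 1%R[%classic : set R) (speed g).
  have [+ _ _] := hspeed g; apply: measurable_funS => //.
  exact: subset_itv_oo_cc.
pose pit : probability (lcc_borel d) R := distribution pi rho.
have pit_test : test_plan pit.
  exists C => // s s0 s1 A mA.
  have [ts0 _] := mul_unit s0 s1.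
  have ts1 : (t * s <= t)%R by rewrite ger_pMr.
  apply: le_trans (bc _ ts0 ts1 _ mA).
  rewrite le_eqVlt; apply/orP; left; apply/eqP.
  rewrite -[LHS]/(pi (rho @^-1` (ev s @^-1` A))) -[RHS]/(pi (ev (t * s) @^-1` A)).
  congr (pi _); apply/funext => g.
  by rewrite /preimage /mkset /ev /rho lcc_restrictE.
have diff0 (g : LCC X) : 0 <= ediff (f (g 1%R)) (f (g 0%R)).
  by apply/ediff_ge0/fc; have [+ _ _ _] := lcc_funP g; apply.
have diff1 := lower_integral_pushforward pi rho diff0.
apply: le_trans (le_trans (subG _ pit_test) (le_trans diff1 _)); last first.
  rewrite le_eqVlt; apply/orP; left; apply/eqP; apply: eq_integral => g _.
  by rewrite /rho !lcc_restrictE// mulr0 mulr1.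
apply: upper_integral_pushforward => g.
  apply: integral_ge0 => s /=; rewrite in_itv/= => /andP[s0 s1].
  by rewrite mule_ge0// speed0.
(* With [r = t s] the factor [t] of the change of variables joins the speed, and [t * speed g (t s)]
   is at most the speed of the restricted curve for almost every [s]. *)
rewrite ge0_integral_scale_unit; last 2 first.
- apply: emeasurable_funM; first exact: measurable_funTS.
  by apply: measurable_funS (mspeed g) => // s /=; rewrite !in_itv/= => /andP[-> /=] /lt_le_trans; exact.
- move=> r r0 rt; rewrite mule_ge0// speed0 ?ltW//.
  exact: lt_le_trans rt t1.
have mGt : measurable_fun (`]0%R, 1%R[%classic : set R)
    (fun s => G (g (t * s)%R) * speed g (t * s)%R).
  apply: (@measurable_comp _ _ _ _ _ _ (`]0%R, 1%R[%classic : set R)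
    (fun r => G (g r) * speed g r)) => //.
  - move=> _ [s + <-]; rewrite /= !in_itv/= => /andP[s0 s1].
    by rewrite mulr_gt0//= (lt_le_trans _ t1)// gtr_pMr.
  - by apply: emeasurable_funM => //; exact: measurable_funTS.
have Gt0 s : `]0%R, 1%R[%classic s -> 0 <= G (g (t * s)%R) * speed g (t * s)%R.
  rewrite /= in_itv/= => /andP[s0 s1].
  have [? ?] := mul_unit (ltW s0) (ltW s1).
  by rewrite mule_ge0// speed0.
have mGs : measurable_fun (`]0%R, 1%R[%classic : set R)
    (fun s => G (rho g s) * speed (rho g) s).
  apply: emeasurable_funM; last exact: mspeed.
  by apply: measurable_funTS; exact: mGg.
rewrite -ge0_integralZl_EFin//; last exact: ltW.
rewrite (@integral_itv_bndoo _ 0%R 1%R _ true false)//.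
apply: ae_ge0_le_integral => //.
- by move=> s s01; rewrite mule_ge0 ?Gt0// lee_fin ltW.
- exact: measurable_funeM.
- move=> s /=; rewrite in_itv/= => /andP[s0 s1].
  by rewrite mule_ge0// speed0// ltW.
have := causal_speed_restrict (hspeed g) (hspeed (lcc_restrict g)).
apply: negligibleS => s /= NP vv'; apply: NP => s01; rewrite muleCA.
rewrite min_l; last by move: s01; rewrite /= in_itv/= => /andP[_ /ltW].
by apply: lee_wpmul2l => //; exact: vv'.
Qed.

End test_plans.
End restriction.

(** * Initial test plans *)

(** Lower limits are taken for fixed real [c < L], then [c] increases to [L]; this reaches [L = +oo]
    too. As [-oo] absorbs [+oo] in [adde], a summand [-oo] makes the claim trivial. *)
Lemma limf_einfD_le (R : realType) (F : set_system R) {FF : Filter F}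
    (M D : R -> \bar R) (L : \bar R) :
  (forall c : R, c%:E < L -> \forall t \near F, c%:E + M t <= D t) ->
  L + limf_einf M F <= limf_einf D F.
Proof.
move=> H.
have H' c : c%:E < L -> c%:E + limf_einf M F <= limf_einf D F.
  move=> cL; rewrite addeC -leeBrDr//.
  rewrite [X in X <= _]limf_einfE; apply: ge_ereal_sup => _ [V FV <-].
  rewrite leeBrDr// addeC [X in _ <= X]limf_einfE.
  pose W := V `&` [set t | c%:E + M t <= D t].
  have FW : F W by apply: filterI => //; exact: H.
  apply: (@le_trans _ _ (ereal_inf (D @` W))); last first.
    by apply: ereal_sup_ubound; exists W.
  apply: le_ereal_inf_tmp => _ [t [Vt /= ct] <-]; apply: le_trans ct.
  by apply: leeD2l; apply: ereal_inf_lbound; exists t.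
have [lNy|lNNy] := eqVneq (limf_einf M F) -oo; first by rewrite lNy addeNy leNye.
case: L H H' => [L||] _ H'; last by rewrite addNye leNye.
- have [ly|lNy] := eqVneq (limf_einf M F) +oo.
    have := H' (L - 1)%R; rewrite lte_fin ltrBlDr ltrDl ltr01 => /(_ isT).
    by rewrite ly !addey.
  have lfin : limf_einf M F \is a fin_num by rewrite fin_numE lNNy.
  apply/lee_addgt0Pr => e e0.
  have := H' (L - e)%R; rewrite lte_fin ltrBlDr ltrDl e0 => /(_ isT).
  by rewrite EFinB -addeAC leeBlDr.
- have Hc c : c%:E + limf_einf M F <= limf_einf D F by apply: H'; rewrite ltry.
  rewrite (_ : limf_einf D F = +oo) ?leey//.
  have [ly|lNy] := eqVneq (limf_einf M F) +oo.
    by apply/eqP; rewrite -leye_eq; have := Hc 0%R; rewrite ly addey.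
  have lfin : limf_einf M F \is a fin_num by rewrite fin_numE lNNy.
  apply/eqyP => r r0; have := Hc (r - fine (limf_einf M F))%R.
  by rewrite -{2}(fineK lfin) -EFinD subrK.
Qed.

Section initial_test_plans.
Context {R : realType} {X : fmm_spacetime R} {d : X -> X -> R}.
Hypotheses (hd : is_distance d) (hdtop : induces_topology d).
Variable pi : probability (lcc_borel d) R.
Implicit Types g : LCC X.
Local Notation leb := (@lebesgue_measure R).

(** Curves are constant outside [[0, 1]], so [marginal] can be a family of measures indexed by the
    whole line. *)
Lemma measurable_evT (r : R) : measurable_fun setT (ev r : lcc_borel d -> borel X).
Proof.
have [r0|r0] := leP r 0%R.
  rewrite (_ : ev r = ev 0%R); first exact: measurable_ev.
  by apply/funext => g; have [_ _ + _] := lcc_funP g; exact.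
have [r1|r1] := leP r 1%R; first exact: (measurable_ev hd hdtop (ltW r0) r1).
rewrite (_ : ev r = ev 1%R); first exact: measurable_ev.
by apply/funext => g; have [_ _ _] := lcc_funP g; apply; exact: ltW.
Qed.

Definition marginal (r : R) : {measure set (borel X) -> \bar R} :=
  image_measure pi (measurable_evT r).

Lemma integral_marginal (r : R) (G : X -> \bar R) :
  measurable_fun setT (G : borel X -> \bar R) -> (forall x, 0 <= G x) ->
  \int[marginal r]_x G x = \int[pi]_g G ((g : LCC X) r).
Proof.
by move=> mG G0; rewrite ge0_integral_pushforward//; exact: measurable_evT.
Qed.

Section fubini.
Variables (G : X -> \bar R) (t : R).
Hypotheses (mG : measurable_fun setT (G : borel X -> \bar R))
  (G0 : forall x, 0 <= G x) (t0 : (0 < t)%R) (t1 : (t <= 1)%R).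

Let I0t : set R := `]0%R, t[%classic.
(** The integrand is extended by zero to all times, so that Tonelli's theorem applies on the full
    product. *)
Let J (z : lcc_borel d * measurableTypeR R) : \bar R :=
  ((fun z => G ((z.1 : LCC X) z.2)) \_ ([set: lcc_borel d] `*` I0t)) z.

Let mJ : measurable_fun setT J.
Proof.
have mD : measurable ([set: lcc_borel d] `*` I0t : set (lcc_borel d * R)).
  by apply: measurableX => //; exact: measurable_itv.
have mD1 : measurable ([set: lcc_borel d] `*` `]0%R, 1%R]%classic : set (lcc_borel d * R)).
  by apply: measurableX => //; exact: measurable_itv.
have := (measurable_restrictT (fun z : lcc_borel d * R => G ((z.1 : LCC X) z.2)) mD).1.
apply; apply: (@measurable_funS _ _ _ _ _ _ _ mD1).
  move=> z [_]; rewrite /I0t /= in_itv/= => /andP[z0 zt]; split => //=.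
  by rewrite in_itv/= z0 (le_trans (ltW zt)).
apply: (@measurable_comp _ _ _ _ _ _ setT (G : borel X -> \bar R)) => //.
exact: (measurable_joint_evaluation hd hdtop).
Qed.

Let J0 z : 0 <= J z.
Proof. by rewrite /J patchE; case: ifP. Qed.

Let JE g : \int[leb]_(r in I0t) G (g r) = \int[leb]_r J (g, r).
Proof.
rewrite integral_mkcond; apply: eq_integral => r _.
by rewrite /J !patchE in_setX in_setT.
Qed.

Lemma measurable_time_integral :
  measurable_fun setT (fun g : lcc_borel d => \int[leb]_(r in I0t) G ((g : LCC X) r)).
Proof.
rewrite (_ : (fun _ => _) = fubini_F leb J).
  exact: measurable_fun_fubini_tonelli_F.
by apply/funext => g; exact: JE.
Qed.

Lemma fubini_time_integral :
  \int[pi]_g \int[leb]_(r in I0t) G ((g : LCC X) r)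
  = \int[leb]_(r in I0t) \int[marginal r]_x G x.
Proof.
transitivity (\int[pi]_g \int[leb]_r J (g, r)).
  by apply: eq_integral => g _; exact: JE.
rewrite (fubini_tonelli J)// [RHS]integral_mkcond; apply: eq_integral => r _.
rewrite patchE /J; case: ifPn => r0t.
  rewrite integral_marginal//; apply: eq_integral => g _.
  by rewrite patchE in_setX in_setT r0t.
rewrite -[RHS](@integral0 _ _ _ pi setT); apply: eq_integral => g _.
by rewrite patchE in_setX in_setT (negbTE r0t).
Qed.

End fubini.
End initial_test_plans.

(** * Averages over short times *)

Lemma le_time_average (R : realType) (phi : R -> \bar R) (c t : R) :
  (0 < t)%R -> (forall r, (0 < r)%R -> (r < t)%R -> 0 <= phi r) ->
  (forall r, (0 < r)%R -> (r < t)%R -> c%:E <= phi r) ->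
  c%:E <= (t^-1)%:E * \int[lebesgue_measure]_(r in `]0%R, t[%classic) phi r.
Proof.
move=> t0 phi0 cphi.
have phi0' r : `]0%R, t[%classic r -> 0 <= phi r.
  by rewrite /= in_itv/= => /andP[]; exact: phi0.
have [c0|c0] := leP c 0%R.
  apply: (@le_trans _ _ 0); first by rewrite lee_fin.
  by rewrite mule_ge0 ?integral_ge0// lee_fin invr_ge0 ltW.
rewrite muleC lee_pdivlMr//.
apply: (@le_trans _ _ (\int[lebesgue_measure]_(r in `]0%R, t[%classic) (cst c%:E) r)).
  by rewrite integral_cst//= lebesgue_measure_itv/= lte_fin t0 -EFinB subr0.
apply: le_lower_integral => r; rewrite /= in_itv/= => /andP[r0 rt].
  by rewrite lee_fin ltW.
exact: cphi.
Qed.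

Lemma time_average_le (R : realType) (phi : R -> \bar R) (c t : R) :
  (0 < t)%R -> (forall r, (0 < r)%R -> (r < t)%R -> 0 <= phi r) ->
  (forall r, (0 < r)%R -> (r < t)%R -> phi r <= c%:E) ->
  (t^-1)%:E * \int[lebesgue_measure]_(r in `]0%R, t[%classic) phi r <= c%:E.
Proof.
move=> t0 phi0 phic; rewrite muleC lee_pdivrMr//.
apply: (@le_trans _ _ (\int[lebesgue_measure]_(r in `]0%R, t[%classic) (cst c%:E) r)).
  apply: le_lower_integral => r; rewrite /= in_itv/= => /andP[].
    exact: phi0.
  exact: phic.
by rewrite integral_cst//= lebesgue_measure_itv/= lte_fin t0 -EFinB subr0.
Qed.

(** Eventual bounds on marginal integrals thus hold on a whole interval []0, t[] and can be averaged
    over it. *)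
Lemma near_at_right0 (R : realType) (P : R -> Prop) :
  (\forall t \near (0%R : R)^'+, P t) ->
  \forall t \near (0%R : R)^'+, forall r, (0 < r)%R -> (r < t)%R -> P r.
Proof.
move=> [e /= e0 eP]; exists e => //= t te t0 r r0 rt; apply: eP => //=.
move: te; rewrite /ball/= !sub0r !normrN !gtr0_norm//.
exact: lt_trans.
Qed.

(** * The inequality at a fixed time *)

Lemma integral_young d (T : measurableType d) (R : realType)
    (mu : {measure set T -> \bar R}) (D : set T) (u v : T -> \bar R) (p q : R) :
  (p^-1 + q^-1 = 1)%R -> (0 < q < 1)%R -> measurable D ->
  measurable_fun D u -> measurable_fun D v ->
  (forall x, D x -> 0 <= u x) -> (forall x, D x -> 0 <= v x) ->
  (q^-1)%:E * \int[mu]_(x in D) epow (v x) q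
  <= \int[mu]_(x in D) (u x * v x)
     + (- p^-1)%:E * \int[mu]_(x in D) epow (u x) p.
Proof.
move=> pq q01 mD mu_ mv u0 v0.
have [q0 q1] := andP q01.
have p'0 : (0 <= - p^-1)%R.
  by rewrite oppr_ge0 -[(p^-1)%R](addrK (q^-1)%R) pq subr_le0 ltW// invf_gt1.
have q'0 : (0 <= q^-1)%R by rewrite invr_ge0 ltW.
have mup : measurable_fun D (fun x => epow (u x) p).
  exact: (measurableT_comp (measurable_epow p) mu_).
have mvq : measurable_fun D (fun x => epow (v x) q).
  exact: (measurableT_comp (measurable_epow q) mv).
have up0 x : D x -> 0 <= epow (u x) p by move=> _; exact: epow_ge0.
have vq0 x : D x -> 0 <= epow (v x) q by move=> _; exact: epow_ge0.
rewrite -(ge0_integralZl_EFin mu mD vq0 mvq q'0).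
rewrite -(ge0_integralZl_EFin mu mD up0 mup p'0).
rewrite -ge0_integralD//=; last 4 first.
- by move=> x Dx; rewrite mule_ge0 ?u0 ?v0.
- exact: emeasurable_funM.
- by move=> x Dx; rewrite mule_ge0 ?up0.
- exact: measurable_funeM.
apply: le_lower_integral => x Dx; first by rewrite mule_ge0 ?vq0.
by apply: epow_young => //; [exact: u0|exact: v0].
Qed.

Section initial_inequality.
Context {R : realType} {X : fmm_spacetime R} {d : X -> X -> R}.
Hypotheses (hd : is_distance d) (hdtop : induces_topology d).
Variable speed : LCC X -> R -> \bar R.
Hypothesis hspeed : forall g : LCC X, is_causal_speed g (speed g).
Variable pi : probability (lcc_borel d) R.
Variables (f df : X -> \bar R) (p q : R).
Hypothesis hf : causal_function f.
Hypothesis hdf : weak_subslope d speed f df.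
Hypotheses (hpq : (p^-1 + q^-1 = 1)%R) (hq1 : (q < 1)%R).
Variables (t C : R).
Hypotheses (t0 : (0 < t)%R) (t1 : (t <= 1)%R) (C0 : (0 < C)%R).
Hypothesis bc :
  forall r, (0 <= r)%R -> (r <= t)%R -> bounded_compression pi r C.
Implicit Types g : LCC X.
Local Notation leb := (@lebesgue_measure R).
Local Notation I0t := (`]0%R, t[%classic : set R).

Definition difference_quotient : \bar R :=
  \int[pi]_g (ediff (f ((g : LCC X) t)) (f ((g : LCC X) 0%R)) * (t^-1)%:E).

(** By Tonelli's theorem this is the mean of [|df|^p(g_r)] over times in []0, t[] and curves; the
    marginal integral stands inside because its behaviour as [r] tends to 0 is what semicontinuity
    controls. *)
Definition mean_subslope_power : \bar R :=
  (t^-1)%:E * \int[leb]_(r in I0t) \int[marginal hd hdtop pi r]_x epow (df x) p.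

Let mdf : measurable_fun setT (df : borel X -> \bar R). Proof. by case: hdf. Qed.
Let df0 x : 0 <= df x. Proof. by case: hdf. Qed.

Let mG : measurable_fun setT ((fun x => epow (df x) p) : borel X -> \bar R).
Proof. exact: (measurableT_comp (measurable_epow p) mdf). Qed.

Let G0 x : 0 <= epow (df x) p.
Proof. exact: epow_ge0. Qed.

Let mI0t : measurable I0t. Proof. exact: measurable_itv. Qed.

Let I0t01 : I0t `<=` `[0%R, 1%R]%classic.
Proof.
move=> r; rewrite /= !in_itv/= => /andP[r0 rt].
by rewrite (ltW r0)/= (le_trans (ltW rt)).
Qed.

Let mspeed g : measurable_fun I0t (speed g).
Proof.
have [mv _ _] := hspeed g; exact: measurable_funS mv.
Qed.

Let speed0 g r : I0t r -> 0 <= speed g r.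
Proof.
by move=> /I0t01; rewrite /= in_itv/= => /andP[r0 r1]; have [_ + _] := hspeed g; exact.
Qed.

(** Of the functions [slope], [A] and [B] of the curve, only [A] is known to be measurable, as it
    does not involve the speed. *)
Let slope g : \bar R := \int[leb]_(r in I0t) (df (g r) * speed g r).
Let A g : \bar R := \int[leb]_(r in I0t) epow (df (g r)) p.
Let B g : \bar R := \int[leb]_(r in I0t) epow (speed g r) q.

Let slope0 g : 0 <= slope g.
Proof. by apply: integral_ge0 => r r0t; rewrite mule_ge0 ?speed0. Qed.
Let A_ge0 g : 0 <= A g.
Proof. by apply: integral_ge0 => r _; exact: epow_ge0. Qed.
Let B_ge0 g : 0 <= B g.
Proof. by apply: integral_ge0 => r _; exact: epow_ge0. Qed.

Let mA : measurable_fun setT (A : lcc_borel d -> \bar R).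
Proof. exact: (measurable_time_integral hd hdtop mG). Qed.

Let intA : mean_subslope_power = (t^-1)%:E * \int[pi]_g A g.
Proof. by rewrite /A (fubini_time_integral hd hdtop pi mG). Qed.

Let mdfg g : measurable_fun I0t (fun r => df (g r)).
Proof. by apply: measurable_funTS; exact: (measurableT_comp mdf (measurable_lcc g)). Qed.

Let mBg g : measurable_fun I0t (fun r => epow (speed g r) q).
Proof. exact: (measurableT_comp (measurable_epow q) (mspeed g)). Qed.

Let mean_speed_powerE :
  mean_speed_power speed pi q t = ((t * q)^-1)%:E * \int[pi]_g B g.
Proof.
rewrite /mean_speed_power; apply: (congr1 (fun z => _ * z)).
apply: eq_integral => g _.
by rewrite (@integral_itv_bndoo _ 0%R t _ true false).
Qed.

Let slope_le : (t^-1)%:E * upper_integral pi slope <= difference_quotient.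
Proof.
have [_ fc] := hf.
have diff0 (g : LCC X) : 0 <= ediff (f (g t)) (f (g 0%R)).
  apply/ediff_ge0/fc; have [cg _ _ _] := lcc_funP g.
  exact: (cg _ _ (lexx _) (ltW t0) t1).
rewrite /difference_quotient.
under [X in _ <= X]eq_integral do rewrite muleC.
have t'0 : (0 < t^-1)%R by rewrite invr_gt0.
rewrite (lower_integralZl pi t'0 diff0).
apply: lee_wpmul2l; first by rewrite lee_fin ltW.
exact: (weak_subslope_initial t0 t1 hd hdtop hspeed C0 bc hf hdf).
Qed.

Let upper_slope_ge0 : 0 <= upper_integral pi slope.
Proof.
apply: le_ereal_inf_tmp => _ [h [mh sh] <-]; apply: integral_ge0 => g _.
exact: le_trans (slope0 g) (sh g).
Qed.

Let t'0 : (0 < t^-1)%R. Proof. by rewrite invr_gt0. Qed.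

(** Here [p < 0]. The subslope term, whose coefficient in Young's inequality is negative, goes to
    the right, where it is the measurable summand of [lower_integral_le_upperD]. *)
Lemma mean_speed_power_le : (0 < q)%R ->
  mean_speed_power speed pi q t
  <= difference_quotient + (- p^-1)%:E * mean_subslope_power.
Proof.
move=> q0; have q01 : (0 < q < 1)%R by rewrite q0.
have p'0 : (0 < - p^-1)%R.
  by rewrite oppr_gt0 -[(p^-1)%R](addrK (q^-1)%R) hpq subr_lt0 invf_gt1.
have q'0 : (0 < q^-1)%R by rewrite invr_gt0.
have pt g : (q^-1)%:E * B g <= slope g + (- p^-1)%:E * A g.
  exact: (integral_young leb hpq q01 mI0t (mdfg g) (mspeed g) (fun r _ => df0 (g r)) (@speed0 g)).
have h1 g : 0 <= (- p^-1)%:E * A g.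
  by apply: mule_ge0; [rewrite lee_fin ltW|exact: A_ge0].
have h2 g : 0 <= (q^-1)%:E * B g.
  by apply: mule_ge0; [rewrite lee_fin ltW|exact: B_ge0].
have h3 : measurable_fun setT ((fun g => (- p^-1)%:E * A g) : lcc_borel d -> \bar R).
  exact: measurable_funeM.
have := lower_integral_le_upperD pi slope0 h1 h2 h3 pt.
rewrite (lower_integralZl pi q'0 B_ge0) (lower_integralZl pi p'0 A_ge0) => main.
rewrite mean_speed_powerE invfM EFinM -muleA.
apply: (@le_trans _ _ ((t^-1)%:E * (upper_integral pi slope + (- p^-1)%:E * \int[pi]_g A g))).
  by rewrite lee_pmul2l ?lte_fin ?t'0.
rewrite (ge0_muleDr _ upper_slope_ge0); last first.
  by apply: mule_ge0; [rewrite lee_fin ltW|apply: integral_ge0 => g _; exact: A_ge0].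
rewrite intA muleCA; apply: leeD2r; exact: slope_le.
Qed.

(** Here [0 < p < 1], so Young's inequality is used with [p] and [q], and slope and speed,
    exchanged. The measurable subslope term is now on the left, as in [integral_le_upper_lowerD]. *)
Lemma mean_subslope_power_le : (q < 0)%R ->
  (p^-1)%:E * mean_subslope_power + mean_speed_power speed pi q t
  <= difference_quotient.
Proof.
move=> q0.
have q'0 : (0 < - q^-1)%R by rewrite oppr_gt0 invr_lt0.
have p'1 : (1 < p^-1)%R by rewrite -[(p^-1)%R](addrK (q^-1)%R) hpq ltrDl.
have p'0 : (0 < p^-1)%R by rewrite (lt_trans _ p'1).
have p0 : (0 < p)%R by rewrite -invr_gt0.
have p01 : (0 < p < 1)%R by rewrite p0 -[p]invrK invf_lt1.
have hqp : (q^-1 + p^-1 = 1)%R by rewrite addrC.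
have pt g : (p^-1)%:E * A g <= slope g + (- q^-1)%:E * B g.
  have -> : slope g = \int[leb]_(r in I0t) (speed g r * df (g r)).
    by apply: eq_integral => r _; rewrite muleC.
  exact: (integral_young leb hqp p01 mI0t (mspeed g) (mdfg g) (@speed0 g) (fun r _ => df0 (g r))).
have h1 g : 0 <= (p^-1)%:E * A g.
  by apply: mule_ge0; [rewrite lee_fin ltW|exact: A_ge0].
have h2 g : 0 <= (- q^-1)%:E * B g.
  by apply: mule_ge0; [rewrite lee_fin ltW|exact: B_ge0].
have h3 : measurable_fun setT ((fun g => (p^-1)%:E * A g) : lcc_borel d -> \bar R).
  exact: measurable_funeM.
have := integral_le_upper_lowerD pi slope0 h1 h2 h3 pt.
rewrite (lower_integralZl pi q'0 B_ge0) (lower_integralZl pi p'0 A_ge0) => main.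
have MN : mean_speed_power speed pi q t
    = - ((t^-1)%:E * ((- q^-1)%:E * \int[pi]_g B g)).
  by rewrite mean_speed_powerE invfM EFinM -muleA EFinN mulNe muleN oppeK.
have IB0 : 0 <= \int[pi]_g B g by apply: integral_ge0 => g _; exact: B_ge0.
have tB0 : 0 <= (t^-1)%:E * ((- q^-1)%:E * \int[pi]_g B g).
  by apply: mule_ge0; [|apply: mule_ge0; [|exact: IB0]]; rewrite lee_fin ltW.
(* If the speed integral is infinite, the left-hand side is [-oo]; otherwise the speed term is
   finite and can be moved to the right. *)
rewrite MN; have [tBy|tBNy] := eqVneq ((t^-1)%:E * ((- q^-1)%:E * \int[pi]_g B g)) +oo.
  by rewrite tBy addeNy leNye.
have tBfin : (t^-1)%:E * ((- q^-1)%:E * \int[pi]_g B g) \is a fin_num.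
  by rewrite (ge0_fin_numE tB0) lt_neqAle tBNy leey.
rewrite leeBlDr; last exact: tBfin.
rewrite intA muleCA.
apply: (@le_trans _ _ ((t^-1)%:E * (upper_integral pi slope + (- q^-1)%:E * \int[pi]_g B g))).
  by rewrite lee_pmul2l ?lte_fin ?t'0.
rewrite (ge0_muleDr _ upper_slope_ge0); last first.
  by apply: mule_ge0; [rewrite lee_fin ltW|exact: IB0].
apply: leeD2r; exact: slope_le.
Qed.

End initial_inequality.

(** * The limit as [t] decreases to 0 *)

Theorem proposition4p1 (R : realType) (X : fmm_spacetime R)
  (d : X -> X -> R)
  (hd : is_distance d) (hdtop : induces_topology d) (hdb : bounded_distance d)
  (speed : LCC X -> R -> \bar R)
  (hspeed : forall g : LCC X, is_causal_speed g (speed g))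
  (E : set (borel X)) (mE : measurable E)
  (pi : probability (lcc_borel d) R)
  (hpi : initial_test_plan pi) (hpiE : stays_initially_in pi E)
  (p q : R) (hpq : (p^-1 + q^-1 = 1)%R) (hq0 : q != 0%R) (hq1 : (q < 1)%R)
  (f : X -> \bar R) (hf : causal_function f)
  (df : X -> \bar R) (hdf : maximal_weak_subslope d speed f df)
  (hi : (p < 0)%R ->
    (refm X).-integrable E (fun x : borel X => epow (df x) p))
  (hii : (q < 0)%R ->
    -oo < limf_einf (fun t : R => mean_speed_power speed pi q t)
                    (0%R : R)^'+) :
  (p^-1)%:E * \int[pi]_g epow (df ((g : LCC X) 0%R)) p
  + limf_einf (fun t : R => mean_speed_power speed pi q t) (0%R : R)^'+
  <= limf_einf (fun t : R =>
       \int[pi]_g (ediff (f ((g : LCC X) t)) (f ((g : LCC X) 0%R))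
                   * (t^-1)%:E)) (0%R : R)^'+.
Proof.
have [[T [C [T0 T1 C0 bc]]] narrow] := hpi.
have [hdf1 _] := hdf; have [mdf df0 _] := hdf1.
have mG : measurable_fun setT ((fun x => epow (df x) p) : borel X -> \bar R).
  exact: (measurableT_comp (measurable_epow p) mdf).
have G0 x : 0 <= epow (df x) p by exact: epow_ge0.
pose mu r := marginal hd hdtop pi r.
have mu1 r : mu r setT = 1.
  by rewrite -[LHS]/(pi (ev r @^-1` setT)) preimage_setT probability_setT.
have near_T : \forall t \near (0%R : R)^'+, (0 < t)%R /\ (t <= T)%R.
  near=> t; split; near: t; [exact: nbhs_right_gt|exact: nbhs_right_le].
rewrite -(integral_marginal hd hdtop pi 0%R mG G0) -/(mu 0%R).
(* It remains to show, for each real [c] below the subslope term at time 0, that [c] plus the mean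
   speed term is at most the difference quotient for all small [t]. *)
apply: limf_einfD_le => c.
have [q0|q0] := ltP 0%R q.
- have p'0 : (0 < - p^-1)%R.
    by rewrite oppr_gt0 -[(p^-1)%R](addrK (q^-1)%R) hpq subr_lt0 invf_gt1.
  have p0 : (p < 0)%R by rewrite -invr_lt0 -oppr_gt0.
  have [T' [T'0 _ stays]] := hpiE.
  have GE : \int[refm X]_(x in E) epow (df x) p < +oo.
    have /integrableP[_] := hi p0.
    by under eq_integral do rewrite gee0_abs//.
  (* Multiplication by [p < 0] reverses the inequality, so upper semicontinuity is called for; the
     integrability (i) provides it. *)
  move=> cp; have {}cp : \int[mu 0%R]_x epow (df x) p < (p * c)%:E.
    have : (- p^-1)%:E * \int[mu 0%R]_x epow (df x) p < (- c)%:E.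
      by rewrite !EFinN mulNe lteN2.
    rewrite muleC -lte_pdivlMr// -EFinM.
    by rewrite invrN invrK mulrN mulNr opprK mulrC.
  have := integral_upper_semicontinuous hd hdtop mu1 T0 C0 bc narrow mE T'0
    stays mG G0 GE cp.
  move=> /near_at_right0; apply: filterS2 near_T => t [t0 tT] Gt.
  have t1 : (t <= 1)%R by rewrite (le_trans tT)// ltW.
  have bct r : (0 <= r)%R -> (r <= t)%R -> bounded_compression pi r C.
    by move=> r0 rt; apply: bc => //; exact: le_trans rt tT.
  have main := mean_speed_power_le hd hdtop hspeed hf hdf1 hpq hq1 t0 t1 C0 bct q0.
  rewrite addeC -leeBrDr//; apply: le_trans main _.
  apply: leeD => //; rewrite -EFinN.
  have -> : (- c)%:E = (- p^-1)%:E * (p * c)%:E.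
    by rewrite -EFinM mulNr mulrA mulVf ?mul1r// lt_eqF.
  rewrite lee_pmul2l// /mean_subslope_power.
  apply: time_average_le => // r r0 rt; first exact: integral_ge0.
  exact/ltW/Gt.
- have {}q0 : (q < 0)%R by rewrite lt_neqAle hq0.
  have p'0 : (0 < p^-1)%R.
    by rewrite -[(p^-1)%R](addrK (q^-1)%R) hpq subr_gt0 (lt_trans _ ltr01)// invr_lt0.
  have p0 : (0 < p)%R by rewrite -invr_gt0.
  (* With [p > 0] the direction is kept, and lower semicontinuity bounds the averages from below by
     [p * c]. *)
  move=> cp; have {}cp : (p * c)%:E < \int[mu 0%R]_x epow (df x) p.
    by rewrite mulrC EFinM -lte_pdivlMr// muleC.
  have := integral_lower_semicontinuous hd hdtop mu1 T0 C0 bc narrow G0 cp.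
  move=> /near_at_right0; apply: filterS2 near_T => t [t0 tT] Gt.
  have t1 : (t <= 1)%R by rewrite (le_trans tT)// ltW.
  have bct r : (0 <= r)%R -> (r <= t)%R -> bounded_compression pi r C.
    by move=> r0 rt; apply: bc => //; exact: le_trans rt tT.
  have main := mean_subslope_power_le hd hdtop hspeed hf hdf1 hpq t0 t1 C0 bct q0.
  apply: le_trans main; apply: leeD2r.
  have -> : c%:E = (p^-1)%:E * (p * c)%:E.
    by rewrite -EFinM mulrA mulVf ?mul1r// gt_eqF.
  rewrite lee_pmul2l// /mean_subslope_power.
  apply: le_time_average => // r r0 rt; first exact: integral_ge0.
  exact/ltW/Gt.
Unshelve. all: by end_near. Qed.
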